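(* Let $k_0>0$, $\varepsilon>0$, let $\omega_0=\omega(k_0)$, $\omega_0'=\partial_k\omega(k_0)$, $\omega_0''=\partial_k^2\omega(k_0)$, $\omega_0'''=\partial_k^3\omega(k_0)$, and let $\alpha,\beta,\gamma$ be the constants given in the context. Consider the reduced Hamiltonian (truncated at fourth order in $\varepsilon$) $$\mathcal{H}=\int\Big[\varepsilon\,\omega_0|u|^2+\varepsilon^2\omega_0'\,\mathrm{Im}(\overline u\,\partial_Xu)+\tfrac12\varepsilon^3\omega_0''|\partial_Xu|^2+\tfrac12\varepsilon^3\alpha|u|^4-\tfrac16\varepsilon^4\omega_0'''\,\mathrm{Im}(\overline u\,\partial_X^3u)+\tfrac12\varepsilon^4\beta|u|^2\,\mathrm{Im}(\overline u\,\partial_Xu)-\tfrac14\varepsilon^4\gamma k_0^2|u|^2|D_X||u|^2\Big]dX .$$ Then the Hamiltonian system $$\partial_t\begin{pmatrix}u\\ \overline u\end{pmatrix}=\varepsilon^{-1}\begin{pmatrix}0&-i\\ i&0\end{pmatrix}\begin{pmatrix}\partial_u\mathcal{H}\\ \partial_{\overline u}\mathcal{H}\end{pmatrix},\qquad\text{i.e.}\quad i\,\partial_tu=\varepsilon^{-1}\partial_{\overline u}\mathcal{H},$$ is the Hamiltonian Dysthe equation $$i\,\partial_tu=\omega_0u-i\varepsilon\omega_0'\partial_Xu-\tfrac12\varepsilon^2\omega_0''\partial_X^2u+\varepsilon^2\alpha|u|^2u+\tfrac{i}{6}\varepsilon^3\omega_0'''\partial_X^3u-i\varepsilon^3\beta|u|^2\partial_Xu-\varepsilon^3\frac{\gamma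 k_0^2}{2}\,u\,|D_X||u|^2 .$$
   Context: Parameters: $g,\mathcal{D},\mathcal{P}$ are real constants, in dimensionless units $g=1$, $\mathcal{D}=1$, $0\le\mathcal{P}<2$. The linear dispersion relation is $\omega(k)=\sqrt{|k|(g-\mathcal{P}k^2+\mathcal{D}k^4)}$; $\omega_{2k_0}=\omega(2k_0)$. The complex-valued wave envelope is $u=u(X,t)$, where $X=\varepsilon x$ is the slow spatial variable; $D_X=-i\partial_X$ and $|D_X|$ is the Fourier multiplier with symbol $|\lambda|$. $\partial_u,\partial_{\overline u}$ denote variational derivatives with $u,\overline u$ treated as independent. The paper's reduced Hamiltonian contains a further $O(\varepsilon^5)$ remainder, which is dropped in the equation. The coefficients are $$\frac{\alpha}{4\pi}=c_0^l-\tfrac12(c_1^l+c_2^l),\qquad\frac{\beta}{8\pi}=c_0^r-\tfrac12(c_1^r+c_2^r),$$ with $\gamma=2$ when $k_0=0.9$ and $\gamma=1$ when $k_0=2$ (the two cases treated; the case distinction reflects whether near-resonant triads contribute), where $$c_0^l=\frac{k_0^3}{8\pi}+\frac{k_0^6}{16\pi\omega_0^2}\Big(\tfrac32\mathcal{P}-5\mathcal{D}k_0^2\Big),$$ $$c_0^r=\frac{3k_0^2}{16\pi}+\frac{k_0^6}{16\pi\omega_0^2}\Big[\Big(\tfrac32\mathcal{P}-5\mathcal{D}k_0^2\Big)\Big(\frac{2}{k_0}+\frac{g+\mathcal{P}k_0^2-3\mathcal{D}k_0^4}{2\omega_0^2}\Big)-5\mathcal{D}k_0\Big],$$ $$c_1^l=\frac{k_0^3\omega_0^2}{4\pi\omega_{2k_0}(2\omega_0+\omega_{2k_0})},\qquad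 c_2^l=-\frac{k_0^3\omega_0^2}{4\pi\omega_{2k_0}(2\omega_0-\omega_{2k_0})},$$ $$c_1^r=\frac{c_1^l}{2}\Big(\frac{3g-5\mathcal{P}k_0^2+7\mathcal{D}k_0^4}{\omega_0^2}+\frac{g+4\mathcal{P}k_0^2-48\mathcal{D}k_0^4}{\omega_{2k_0}^2}-\frac{g-12\mathcal{P}k_0^2+80\mathcal{D}k_0^4}{\omega_{2k_0}(2\omega_0+\omega_{2k_0})}-\frac{g-3\mathcal{P}k_0^2+5\mathcal{D}k_0^4}{\omega_0(2\omega_0+\omega_{2k_0})}\Big),$$ $$c_2^r=\frac{c_2^l}{2}\Big(\frac{3g-5\mathcal{P}k_0^2+7\mathcal{D}k_0^4}{\omega_0^2}+\frac{g+4\mathcal{P}k_0^2-48\mathcal{D}k_0^4}{\omega_{2k_0}^2}+\frac{g-12\mathcal{P}k_0^2+80\mathcal{D}k_0^4}{\omega_{2k_0}(2\omega_0-\omega_{2k_0})}-\frac{g-3\mathcal{P}k_0^2+5\mathcal{D}k_0^4}{\omega_0(2\omega_0-\omega_{2k_0})}\Big).$$ *)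

(* Defs.v *)
From HB Require Import structures.
From mathcomp Require Import all_boot all_order all_algebra.
From mathcomp Require Import all_classical all_reals all_analysis.
From mathcomp Require Import complex.

Set Implicit Arguments.
Unset Strict Implicit.
Unset Printing Implicit Defensive.

Import Order.TTheory GRing.Theory Num.Theory.
Import numFieldNormedType.Exports.

Local Open Scope ring_scope.
Local Open Scope classical_set_scope.
Local Open Scope complex_scope.

(* Real-valued real and imaginary parts. *)
Local Notation Re := complex.Re.
Local Notation Im := complex.Im.

(* Calculus of complex-valued functions of a real variable, taken on real and
   imaginary parts. *)
Section ComplexValued.
Context {R : realType}.
Implicit Types f : R -> R[i].

Definition cderivable f (x : R) : Prop :=
  derivable (fun y => Re (f y)) x 1 /\ derivable (fun y => Im (f y)) x 1.

Definition cderive f (x : R) : R[i] :=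
  (fun y => Re (f y))^`() x +i* (fun y => Im (f y))^`() x.

Definition cderiven (n : nat) f : R -> R[i] := iter n cderive f.

Definition ccontinuous f : Prop :=
  continuous (fun y => Re (f y)) /\ continuous (fun y => Im (f y)).

Definition cintegral f : R[i] :=
  (\int[lebesgue_measure]_x Re (f x)) +i* (\int[lebesgue_measure]_x Im (f x)).

Definition square_integrable f : Prop :=
  measurable_fun setT (fun x => Re (f x)) /\
  measurable_fun setT (fun x => Im (f x)) /\
  lebesgue_measure.-integrable setT
    (fun x => (Re (f x) ^+ 2 + Im (f x) ^+ 2)%:E).

Definition expi (x : R) : R[i] := cos x +i* sin x.

Definition fourier f (lambda : R) : R[i] :=
  cintegral (fun x => f x * expi (- (lambda * x))).

(* The Fourier multiplier |D_X|, where D_X = -i d/dX has symbol lambda. *)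
Definition absD f (x : R) : R[i] :=
  ((2 * pi)^-1)%:C *
  cintegral (fun lambda => `|lambda|%:C * fourier f lambda * expi (lambda * x)).

(* The phase space: C^3 functions in the Sobolev space H^3.  On it the
   integrals defining [hamiltonian] below, and those defining
   |D_X| |u|^2, converge absolutely. *)
Definition envelope f : Prop :=
  (forall n x, (n < 3)%N -> cderivable (cderiven n f) x) /\
  ccontinuous (cderiven 3 f) /\
  (forall n, (n <= 3)%N -> square_integrable (cderiven n f)).

Definition compactly_supported f : Prop :=
  exists M : R, forall x, M < `|x| -> f x = 0.

(* [p] and [q] are the variational derivatives of [F] at [u] with respect to
   [u] and to its conjugate, regarded as independent:
     dF(u)[h] = \int (p h + q \bar h) dX.
   As [h] may be replaced by ['i * h], the linear and antilinear parts of
   dF(u) determine [p] and [q] separately. *)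
Definition is_variational_derivatives (F : (R -> R[i]) -> R[i])
    (u p q : R -> R[i]) : Prop :=
  [/\ ccontinuous p, ccontinuous q &
   forall h, envelope h -> compactly_supported h ->
     let Fh (s : R) := F (fun x => u x + s%:C * h x) in
     cderivable Fh 0 /\
     cderive Fh 0 = cintegral (fun x => p x * h x + q x * (h x)^*)].

(* The value 0 is taken when the variational derivatives do not exist. *)
Definition variational_derivatives (F : (R -> R[i]) -> R[i]) (u : R -> R[i]) :
    (R -> R[i]) * (R -> R[i]) :=
  xget (fun=> 0, fun=> 0) [set pq | is_variational_derivatives F u pq.1 pq.2].

Definition d_u F u : R -> R[i] := (variational_derivatives F u).1.

Definition d_ubar F u : R -> R[i] := (variational_derivatives F u).2.

End ComplexValued.

Section Dysthe.
Context {R : realType}.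
(* [k0] is the carrier wavenumber. *)
Variables (g D P k0 : R).

Definition omega (k : R) : R :=
  Num.sqrt (`|k| * (g - P * k ^+ 2 + D * k ^+ 4)).

Local Notation w0 := (omega k0).
Local Notation w2 := (omega (2 * k0)).
Local Notation dw n := (derive1n n omega k0).

Definition c0l : R :=
  k0 ^+ 3 / (8 * pi)
  + k0 ^+ 6 / (16 * pi * w0 ^+ 2) * (3 / 2 * P - 5 * D * k0 ^+ 2).

Definition c0r : R :=
  3 * k0 ^+ 2 / (16 * pi)
  + k0 ^+ 6 / (16 * pi * w0 ^+ 2) *
    ((3 / 2 * P - 5 * D * k0 ^+ 2) *
     (2 / k0 + (g + P * k0 ^+ 2 - 3 * D * k0 ^+ 4) / (2 * w0 ^+ 2))
     - 5 * D * k0).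

Definition c1l : R := k0 ^+ 3 * w0 ^+ 2 / (4 * pi * w2 * (2 * w0 + w2)).

(* At a second-harmonic resonance, 2 w0 = w2, this coefficient is undefined in
   the usual sense; here it is then 0. *)
Definition c2l : R := - (k0 ^+ 3 * w0 ^+ 2 / (4 * pi * w2 * (2 * w0 - w2))).

Definition c1r : R :=
  c1l / 2 *
  ((3 * g - 5 * P * k0 ^+ 2 + 7 * D * k0 ^+ 4) / w0 ^+ 2
   + (g + 4 * P * k0 ^+ 2 - 48 * D * k0 ^+ 4) / w2 ^+ 2
   - (g - 12 * P * k0 ^+ 2 + 80 * D * k0 ^+ 4) / (w2 * (2 * w0 + w2))
   - (g - 3 * P * k0 ^+ 2 + 5 * D * k0 ^+ 4) / (w0 * (2 * w0 + w2))).

Definition c2r : R :=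
  c2l / 2 *
  ((3 * g - 5 * P * k0 ^+ 2 + 7 * D * k0 ^+ 4) / w0 ^+ 2
   + (g + 4 * P * k0 ^+ 2 - 48 * D * k0 ^+ 4) / w2 ^+ 2
   + (g - 12 * P * k0 ^+ 2 + 80 * D * k0 ^+ 4) / (w2 * (2 * w0 - w2))
   - (g - 3 * P * k0 ^+ 2 + 5 * D * k0 ^+ 4) / (w0 * (2 * w0 - w2))).

Definition alpha : R := 4 * pi * (c0l - (c1l + c2l) / 2).

Definition beta : R := 8 * pi * (c0r - (c1r + c2r) / 2).

Variables (eps gamma : R).

Definition hamiltonian (u : R -> R[i]) : R[i] :=
  cintegral (fun X =>
    (eps * w0)%:C * `|u X| ^+ 2
    + (eps ^+ 2 * dw 1)%:C * (Im ((u X)^* * cderiven 1 u X))%:C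
    + (eps ^+ 3 * dw 2 / 2)%:C * `|cderiven 1 u X| ^+ 2
    + (eps ^+ 3 * alpha / 2)%:C * `|u X| ^+ 4
    - (eps ^+ 4 * dw 3 / 6)%:C * (Im ((u X)^* * cderiven 3 u X))%:C
    + (eps ^+ 4 * beta / 2)%:C * `|u X| ^+ 2 *
        (Im ((u X)^* * cderiven 1 u X))%:C
    - (eps ^+ 4 * gamma * k0 ^+ 2 / 4)%:C * `|u X| ^+ 2 *
        absD (fun Y => `|u Y| ^+ 2) X).

(* Equations for an envelope u(X,t), written at time t for all X. *)

Definition hamiltonian_system (u : R -> R -> R[i]) (t : R) : Prop :=
  forall X : R,
    cderive (u X) t =
      (eps^-1)%:C * (0 * d_u hamiltonian (u^~ t) X
                     - 'i * d_ubar hamiltonian (u^~ t) X) /\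
    cderive (fun s => (u X s)^*) t =
      (eps^-1)%:C * ('i * d_u hamiltonian (u^~ t) X
                     + 0 * d_ubar hamiltonian (u^~ t) X).

Definition hamiltonian_equation (u : R -> R -> R[i]) (t : R) : Prop :=
  forall X : R,
    'i * cderive (u X) t = (eps^-1)%:C * d_ubar hamiltonian (u^~ t) X.

Definition dysthe_equation (u : R -> R -> R[i]) (t : R) : Prop :=
  forall X : R,
    'i * cderive (u X) t =
      w0%:C * u X t
      - 'i * (eps * dw 1)%:C * cderiven 1 (u^~ t) X
      - (eps ^+ 2 * dw 2 / 2)%:C * cderiven 2 (u^~ t) X
      + (eps ^+ 2 * alpha)%:C * `|u X t| ^+ 2 * u X t
      + 'i / 6 * (eps ^+ 3 * dw 3)%:C * cderiven 3 (u^~ t) X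
      - 'i * (eps ^+ 3 * beta)%:C * `|u X t| ^+ 2 * cderiven 1 (u^~ t) X
      - (eps ^+ 3 * (gamma * k0 ^+ 2 / 2))%:C * u X t *
          absD (fun Y => `|u Y t| ^+ 2) X.

End Dysthe.

(* Main.v *)
Require Import Defs.
From HB Require Import structures.
From mathcomp Require Import all_boot all_order all_algebra.
From mathcomp Require Import all_classical all_reals all_analysis.
From mathcomp Require Import measurable_realfun complex.
From mathcomp Require Import ring lra.

Set Implicit Arguments.
Unset Strict Implicit.
Unset Printing Implicit Defensive.

Import Order.TTheory GRing.Theory Num.Theory.
Import numFieldNormedType.Exports.

Local Open Scope ring_scope.
Local Open Scope classical_set_scope.
Local Open Scope complex_scope.

(** Write v = a + i b for the envelope and h = phi + i psi for a test function.
    The energy density is a polynomial in a, b, their derivatives and |D||v|^2,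
    and |D| is linear; so at v + s h it is a quartic polynomial in s
    ([density_quartic]), and the derivative of the energy at s = 0 is the integral
    of the coefficient of s.
    No limit is ever exchanged with an integral for this step; all the analysis
    lies in showing that the coefficients are integrable and |D||v|^2 is bounded.

    For the latter, let f = |v|^2. As v is in H^3, f and its first three
    derivatives are integrable, so the Fourier transform of f decays like the
    inverse cube of the frequency ([W31_decay]); |D|f is then an absolutely
    convergent oscillatory integral, bounded and continuous ([bdd_absDr]). Fubini
    shows that |D| is symmetric ([absDr_sym]), which gives the factor two in the
    nonlocal term. On real functions |D| is real, since the imaginary part of the
    defining integral has an odd integrand ([absD_real]).

    That integral is 2 Re of the integral of q conj(h), where
    q = grad_re + i grad_im is eps times the right-hand side of the Dysthe
    equation, plus the integral of the derivative of an integrable flux and a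
    difference that vanishes by symmetry of |D| ([first_variation]). A C^1
    function that is integrable with its derivative tends to zero at infinity,
    so that its derivative has integral zero ([int_deriv_eq0]); this gives the
    integrations by parts and the decay of the Fourier transform. The estimate
    behind it, [pointwise_le], also gives the boundedness of functions in H^1
    ([L1_bdd]).

    Thus (conj q, q) is a pair of variational derivatives. It is the only one by
    testing against C^3 cutoffs multiplied by 1 and by i
    ([variational_derivatives_unique]). As the derivative in u is the conjugate of
    the one in conj u, the second equation of the Hamiltonian system is the
    conjugate of the first. *)

(** * Integrable functions on the real line *)

Section RealLine.
Context {R : realType}.
Notation mu := (@lebesgue_measure R).
Implicit Types f g : R -> R.
Implicit Types a b z : R.

(** Continuity is part of [L1], [L2] and [bdd]: all functions below are continuous,
    and this makes every measurability condition automatic. *)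
Definition L1 f := continuous f /\ mu.-integrable setT (EFin \o f).
Definition L2 f := L1 (fun x => f x * f x) /\ continuous f.
Definition has_deriv f f' := forall x : R, is_derive x (1 : R) f (f' x).
Definition bdd f := continuous f /\ exists M, forall x, `|f x| <= M.

Lemma continuous_mul f g : continuous f -> continuous g -> continuous (fun x => f x * g x).
Proof. by move=> cf cg x; apply: cvgM; [apply: cf|apply: cg]. Qed.

Lemma continuous_add f g : continuous f -> continuous g -> continuous (fun x => f x + g x).
Proof. by move=> cf cg x; apply: cvgD; [apply: cf|apply: cg]. Qed.

Lemma continuous_opp f : continuous f -> continuous (fun x => - f x).
Proof. by move=> cf x; apply: cvgN; apply: cf. Qed.

Lemma continuous_cst c : continuous (fun _ : R => c : R).
Proof. by move=> x; apply: cvg_cst. Qed.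

Lemma L1_le f g : continuous f -> (forall x, `|f x| <= g x) ->
  mu.-integrable setT (EFin \o g) -> L1 f.
Proof.
move=> cf fg ig; split => //.
apply: (le_integrable _ _ _ ig) => //.
  by apply/measurable_EFinP; exact: continuous_measurable_fun.
by move=> x _ /=; rewrite lee_fin (le_trans (fg x))// ler_norm.
Qed.

Lemma L1D f g : L1 f -> L1 g -> L1 (fun x => f x + g x).
Proof.
by move=> [cf If] [cg Ig]; split; [exact: continuous_add|exact: (integrableD _ If Ig)].
Qed.

Lemma L1Z c f : L1 f -> L1 (fun x => c * f x).
Proof.
move=> [cf If]; split; [exact: (continuous_mul (@continuous_cst c))|exact: (integrableZl _ c If)].
Qed.

Lemma L1N f : L1 f -> L1 (fun x => - f x).
Proof.
by move=> [cf If]; split; [exact: continuous_opp|by have := integrableN If].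
Qed.

Lemma L1B f g : L1 f -> L1 g -> L1 (fun x => f x - g x).
Proof. by move=> If Ig; apply: L1D => //; exact: L1N. Qed.

Lemma L1abs f : L1 f -> L1 (fun x => `|f x|).
Proof.
move=> [cf If]; split; last exact: (integrable_norm If).
by move=> x; apply: cvg_norm; exact: cf.
Qed.

Lemma L1Mb f g : L1 f -> bdd g -> L1 (fun x => f x * g x).
Proof.
move=> If [cg [M gM]].
apply: (@L1_le _ (fun x => M * `|f x|)); first by apply: continuous_mul => //; case: If.
  by move=> x; rewrite normrM mulrC ler_wpM2r.
by have [] := L1Z M (L1abs If).
Qed.

Lemma L1bM f g : bdd f -> L1 g -> L1 (fun x => f x * g x).
Proof.
by move=> bf Ig; under eq_fun do rewrite mulrC; exact: L1Mb.
Qed.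

Lemma L2M f g : L2 f -> L2 g -> L1 (fun x => f x * g x).
Proof.
move=> [If cf] [Ig cg].
apply: (@L1_le _ (fun x => f x * f x + g x * g x)); first exact: continuous_mul.
  move=> x; rewrite ler_norml.
  by have := sqr_ge0 (f x + g x); have := sqr_ge0 (f x - g x); nra.
by have [] := L1D If Ig.
Qed.

Lemma bddM f g : bdd f -> bdd g -> bdd (fun x => f x * g x).
Proof.
move=> [cf [M fM]] [cg [N gN]]; split; first exact: continuous_mul.
by exists (M * N) => x; rewrite normrM ler_pM.
Qed.

Lemma bddD f g : bdd f -> bdd g -> bdd (fun x => f x + g x).
Proof.
move=> [cf [M fM]] [cg [N gN]]; split; first exact: continuous_add.
by exists (M + N) => x; rewrite (le_trans (ler_normD _ _))// lerD.
Qed.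

Lemma bddC c : bdd (fun _ => c).
Proof. by split; [exact: continuous_cst|exists `|c|]. Qed.

Lemma bddN f : bdd f -> bdd (fun x => - f x).
Proof. by move=> [cf [M fM]]; split; [exact: continuous_opp|exists M => x; rewrite normrN]. Qed.

Lemma L2D f g : L2 f -> L2 g -> L2 (fun x => f x + g x).
Proof.
move=> Hf Hg; split; last by apply: continuous_add; [case: Hf|case: Hg].
rewrite (_ : (fun x => _) = fun x => f x * f x + (2 * (f x * g x) + g x * g x)).
  by apply: L1D; [exact: L2M|apply: L1D; [apply: L1Z|]; exact: L2M].
by apply/funext => x; ring.
Qed.

Lemma L2Z c f : L2 f -> L2 (fun x => c * f x).
Proof.
move=> [If cf]; split; last exact: (continuous_mul (@continuous_cst c)).
rewrite (_ : (fun x => _) = fun x => (c * c) * (f x * f x)); first exact: L1Z.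
by apply/funext => x; ring.
Qed.

Lemma L1_0 : L1 (fun _ : R => 0 : R).
Proof.
split; first exact: continuous_cst.
rewrite (_ : EFin \o _ = cst 0%E); first exact: integrable0.
exact/funext.
Qed.

Lemma L2_0 : L2 (fun _ : R => 0 : R).
Proof.
split; last exact: continuous_cst.
by under eq_fun do rewrite mul0r; exact: L1_0.
Qed.

Lemma L2B f g : L2 f -> L2 g -> L2 (fun x => f x - g x).
Proof.
move=> Hf Hg; rewrite (_ : (fun x => _) = fun x => f x + -1 * g x).
  by apply: L2D => //; exact: L2Z.
by apply/funext => x; rewrite mulN1r.
Qed.

Lemma L2bM f g : bdd f -> L2 g -> L2 (fun x => f x * g x).
Proof.
move=> bf [Ig cg]; split; last by apply: continuous_mul => //; case: bf.
rewrite (_ : (fun x => _) = fun x => (f x * f x) * (g x * g x)).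
  by apply: L1bM => //; exact: bddM.
by apply/funext => x; ring.
Qed.

Lemma bddB f g : bdd f -> bdd g -> bdd (fun x => f x - g x).
Proof. by move=> bf bg; apply: bddD => //; exact: bddN. Qed.

Lemma intD f g : L1 f -> L1 g ->
  \int[mu]_x (f x + g x) = \int[mu]_x f x + \int[mu]_x g x.
Proof. by move=> [_ If] [_ Ig]; rewrite RintegralD. Qed.

Lemma intB f g : L1 f -> L1 g ->
  \int[mu]_x (f x - g x) = \int[mu]_x f x - \int[mu]_x g x.
Proof. by move=> [_ If] [_ Ig]; rewrite RintegralB. Qed.

Lemma intZ c f : L1 f -> \int[mu]_x (c * f x) = c * \int[mu]_x f x.
Proof. by move=> [_ If]; rewrite RintegralZl. Qed.

Lemma int_abs f : L1 f -> `|\int[mu]_x f x| <= \int[mu]_x `|f x|.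
Proof. by move=> [_ If]; exact: le_normr_Rintegral. Qed.

Lemma L1_sub f (D : set R) : measurable D -> L1 f -> mu.-integrable D (EFin \o f).
Proof. by move=> mD [_ If]; exact: (integrableS _ _ _ If). Qed.

(** Dominated convergence along the symmetric intervals [-n, n]. *)
Lemma cvg_int_sym f : L1 f ->
  \int[mu]_(x in `[- n%:R, n%:R]) f x @[n --> \oo] --> \int[mu]_x f x.
Proof.
move=> [cf If].
have H : (\int[mu]_x ((EFin \o (f \_ `[(- n%:R)%R, n%:R%R])) x))%E @[n --> \oo] -->
    (\int[mu]_x (EFin \o f) x)%E.
  apply: (@dominated_cvg _ _ R mu setT measurableT
    (fun n => EFin \o (f \_ `[- n%:R, n%:R])) (EFin \o f)
    (EFin \o (fun x => `|f x|))).
  - move=> n; apply/measurable_EFinP.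
    by apply/(measurable_restrictT _ _).1 => //; apply: measurable_funTS; 
    exact: continuous_measurable_fun.
  - move=> x _; apply: cvg_near_cst.
    near=> n => /=; rewrite patchE mem_set//= in_itv/= -ler_norml.
    near: n; exists (Num.truncn `|x|).+1 => // n /= xn.
    by apply: ltW; rewrite (lt_le_trans (truncnS_gt _))// ler_nat.
  - by move=> x _.
  - exact: (integrable_norm If).
  - move=> n x _ /=; rewrite lee_fin patchE; case: ifP => // _.
    by rewrite normr0.
have {}H : (\int[mu]_x (f \_ `[- n%:R, n%:R]) x)%:E @[n --> \oo] -->
   (\int[mu]_x f x)%:E.
  rewrite /Rintegral fineK; last exact: integrable_fin_num.
  apply: cvg_trans H; apply: near_eq_cvg; near=> n; rewrite fineK//.
  apply: integrable_fin_num => //.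
  rewrite (_ : (fun x => _) = (EFin \o f) \_ `[- n%:R, n%:R]); last first.
    by rewrite restrict_EFin.
  apply: (iffLR (integrable_mkcond _ _)) => //.
  exact: (integrableS _ _ _ If).
under eq_fun do rewrite Rintegral_mkcond.
exact: (fine_cvg H).
Unshelve. all: by end_near. Qed.

Lemma integral_has_deriv f f' a b : a <= b -> has_deriv f f' -> continuous f' ->
  \int[mu]_(x in `[a, b]) f' x = f b - f a.
Proof.
rewrite le_eqVlt => /orP[/eqP <-|ab] df cf'.
  by rewrite set_itv1 Rintegral_set1 subrr.
have cf : continuous f.
  by move=> x; apply: differentiable_continuous; apply/derivable1_diffP; case: (df x).
rewrite /Rintegral (@continuous_FTC2 _ f' f)//.
- exact: continuous_subspaceT.
- split; first by move=> x _; case: (df x).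
  + by apply: cvg_at_right_filter; apply: cf.
  + by apply: cvg_at_left_filter; apply: cf.
- by move=> x _; rewrite derive1E; case: (df x).
Qed.

(** Average |f z| <= |f x| + (integral of |f'|) over x in an interval of length one. *)
Lemma pointwise_le f f' a z : has_deriv f f' ->
  L1 f -> L1 f' -> a <= z <= a + 1 ->
  `|f z| <= \int[mu]_(x in `[a, a + 1]) (`|f x| + `|f' x|).
Proof.
move=> df If If' zi.
have I1 : mu.-integrable `[a, a + 1] (EFin \o (fun x => `|f x|)).
  by apply: L1_sub => //; exact: L1abs.
have I2 : mu.-integrable `[a, a + 1] (EFin \o (fun x => `|f' x|)).
  by apply: L1_sub => //; exact: L1abs.
rewrite RintegralD//.
set J := \int[mu]_(x in `[a, a+1]) `|f' x|.
have mab : lebesgue_measure `[a, a + 1] = 1%:E :> \bar R.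
  rewrite lebesgue_measure_itv/= lte_fin ltrDl ltr01 -EFinB; congr EFin; ring.
have key x y : a <= x -> y <= a + 1 -> x <= y -> `|f y - f x| <= J.
  move=> ax ya xy; rewrite -(integral_has_deriv xy df (proj1 If')).
  have S : `[x, y] `<=` `[a, a + 1].
    by move=> t /=; rewrite !in_itv/= => /andP[? ?]; lra.
  rewrite (le_trans (le_normr_Rintegral _ _))//; first exact: L1_sub.
  rewrite /J /Rintegral fine_le//.
  - by apply: integrable_fin_num => //; exact: L1_sub (L1abs If').
  - by apply: integrable_fin_num.
  - apply: ge0_subset_integral => //.
    by apply/measurable_EFinP; apply: measurable_funTS;
      apply: continuous_measurable_fun; case: (L1abs If').
have key2 x : a <= x -> x <= a + 1 -> `|f z| - J <= `|f x|.
  move=> ax xa; rewrite lerBlDr -lerBlDl (le_trans (lerB_dist _ _))//.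
  case/andP: zi => az za.
  by have [xz|/ltW xz] := leP x z; [|rewrite distrC]; apply: key.
rewrite -lerBlDr.
have -> : `|f z| - J = \int[mu]_(x in `[a, a+1]) (`|f z| - J).
  by rewrite Rintegral_cst// (_ : fine _ = 1) ?mulr1//; exact: (congr1 fine mab).
apply: le_Rintegral => //.
  apply: continuous_compact_integrable; first exact: segment_compact.
  by apply: continuous_subspaceT; exact: continuous_cst.
by move=> x /=; rewrite in_itv/= => /andP[? ?]; exact: key2.
Qed.

Lemma int_sub_le f (D E : set R) : measurable D -> measurable E -> D `<=` E ->
  (forall x, 0 <= f x) -> L1 f ->
  \int[mu]_(x in D) f x <= \int[mu]_(x in E) f x.
Proof.
move=> mD mE DE f0 If; rewrite /Rintegral fine_le//.
- by apply: integrable_fin_num => //; apply: L1_sub If.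
- by apply: integrable_fin_num => //; apply: L1_sub If.
- apply: ge0_subset_integral => //.
    by apply/measurable_EFinP; apply: measurable_funTS; apply: continuous_measurable_fun; case: If.
  by move=> y _ /=; rewrite lee_fin.
Qed.

(** Applied to f = w^2 this is the embedding of H^1 into the bounded functions. *)
Lemma L1_bdd f f' : has_deriv f f' -> L1 f -> L1 f' -> bdd f.
Proof.
move=> df If If'; split; first by case: If.
exists (\int[mu]_x (`|f x| + `|f' x|)) => x.
rewrite (le_trans (pointwise_le df If If' (a := x) _))//.
  by rewrite lexx ler_wpDr.
have IJ := L1D (L1abs If) (L1abs If').
by apply: int_sub_le => // y; rewrite addr_ge0.
Qed.

(** The integral of f' over [-n, n] is f n - f (- n). By [pointwise_le] both values
    are at most the integral of |f| + |f'| over [-n-1, n+1] minus [-n, n], which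
    tends to zero. *)
Lemma int_deriv_eq0 f f' : has_deriv f f' -> L1 f -> L1 f' ->
  \int[mu]_x f' x = 0.
Proof.
move=> df If If'.
(* H n is the integral of h over [-n, n]; its increments tend to zero. *)
pose h x := `|f x| + `|f' x|.
have Ih : L1 h by apply: L1D; exact: L1abs.
have h0 x : 0 <= h x by rewrite addr_ge0.
pose H n := \int[mu]_(x in `[- n%:R, n%:R]) h x.
have cH : H n @[n --> \oo] --> \int[mu]_x h x by exact: cvg_int_sym.
have cHS : H n.+1 @[n --> \oo] --> \int[mu]_x h x.
  by move: cH; rewrite -(cvg_shiftS H).
have c0 : (H n.+1 - H n) @[n --> \oo] --> (0 : R).
  by rewrite -(subrr (\int[mu]_x h x)); exact: cvgB.
(* Unit intervals lying between [-n, n] and [-n-1, n+1], at the right end and, with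
   ann', at the left end; the shared endpoint is removed to make them disjoint. *)
have ann a n : `[a, a + 1] `<=` `[- n.+1%:R, n.+1%:R] ->
    [disjoint `[- (n%:R : R), n%:R[ & `[a, a + 1]] ->
    \int[mu]_(x in `[a, a + 1]) h x <= H n.+1 - H n.
  move=> sub disj.
  rewrite lerBrDr /H -(@Rintegral_itv_bndo_bndc _ (BLeft (- n%:R)) n%:R); last exact: L1_sub Ih.
  rewrite addrC -Rintegral_setU//; last first.
    by apply: L1_sub => //; exact: measurableU.
  apply: int_sub_le => //; first exact: measurableU.
  move=> x [/=|]; last exact: sub.
  rewrite !in_itv/= => /andP[x1 x2]; rewrite -natr1; lra.
have ann' a n : `[a, a + 1] `<=` `[- n.+1%:R, n.+1%:R] ->
    [disjoint `]- (n%:R : R), n%:R] & `[a, a + 1]] ->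
    \int[mu]_(x in `[a, a + 1]) h x <= H n.+1 - H n.
  move=> sub disj.
  rewrite lerBrDr /H -(@Rintegral_itv_obnd_cbnd _ (- n%:R) (BRight n%:R)); last exact: L1_sub Ih.
  rewrite addrC -Rintegral_setU//; last first.
    by apply: L1_sub => //; exact: measurableU.
  apply: int_sub_le => //; first exact: measurableU.
  move=> x [/=|]; last exact: sub.
  rewrite !in_itv/= => /andP[x1 x2]; rewrite -natr1; lra.
have e n : `|f n%:R - f (- n%:R)| <= (H n.+1 - H n) + (H n.+1 - H n).
  have n0 : (0 : R) <= n%:R by [].
  rewrite (le_trans (ler_normB _ _))// lerD//.
    rewrite (le_trans (pointwise_le df If If' (a := n%:R) _))//.
      by rewrite lexx ler_wpDr.
    apply: ann; first by move=> x /=; rewrite !in_itv/= => /andP[? ?]; rewrite -natr1; lra.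
    by apply/disj_setPS => x [/=]; rewrite !in_itv/= => /andP[? ?] /andP[? ?]; lra.
  rewrite (le_trans (pointwise_le df If If' (a := - n%:R - 1) _))//.
    by rewrite subrK lexx andbT gerBl.
  apply: ann'; first by move=> x /=; rewrite !in_itv/= => /andP[? ?]; rewrite -natr1; lra.
  by apply/disj_setPS => x [/=]; rewrite !in_itv/= => /andP[? ?] /andP[? ?]; lra.
have c1 : (f n%:R - f (- n%:R)) @[n --> \oo] --> \int[mu]_x f' x.
  have := cvg_int_sym If'.
  under eq_fun => n do rewrite (@integral_has_deriv f f' (- n%:R) n%:R
    (ge0_cp (ler0n R _)).2 df (proj1 If')).
  exact.
have c2 : (f n%:R - f (- n%:R)) @[n --> \oo] --> (0 : R).
  have c00 : (H n.+1 - H n) + (H n.+1 - H n) @[n --> \oo] --> (0 : R).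
    by rewrite -[X in _ --> X]addr0; exact: cvgD.
  have c0N : - (H n.+1 - H n + (H n.+1 - H n)) @[n --> \oo] --> (0 : R).
    by rewrite -oppr0; exact: cvgN.
  apply: (squeeze_cvgr _ c0N c00); near=> n.
  by rewrite -ler_norml e.
exact: (cvg_unique _ c1 c2).
Unshelve. all: by end_near. Qed.

End RealLine.

(** * Derivatives *)

Section Calculus.
Context {R : realType}.
Notation mu := (@lebesgue_measure R).
Implicit Types f g : R -> R.
Implicit Types a b z x y l : R.

Lemma has_deriv_eq f g h : has_deriv f g -> g =1 h -> has_deriv f h.
Proof. by move=> fg gh x; rewrite -gh. Qed.

Lemma has_derivM f f' g g' : has_deriv f f' -> has_deriv g g' ->
  has_deriv (fun x => f x * g x) (fun x => f' x * g x + f x * g' x).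
Proof.
move=> df dg x; apply: is_derive_eq.
  exact: (@is_deriveM _ _ f g x 1 _ _ (df x) (dg x)).
by change (f x * g' x + g x * f' x = f' x * g x + f x * g' x); ring.
Qed.

Lemma has_derivD f f' g g' : has_deriv f f' -> has_deriv g g' ->
  has_deriv (fun x => f x + g x) (fun x => f' x + g' x).
Proof. by move=> df dg x; exact: (@is_deriveD _ _ _ f g x 1 _ _ (df x) (dg x)). Qed.

Lemma has_derivN f f' : has_deriv f f' -> has_deriv (fun x => - f x) (fun x => - f' x).
Proof. by move=> df x; exact: (@is_deriveN _ _ _ f x 1 _ (df x)). Qed.

Lemma has_derivB f f' g g' : has_deriv f f' -> has_deriv g g' ->
  has_deriv (fun x => f x - g x) (fun x => f' x - g' x).
Proof. by move=> df dg; apply: has_derivD => //; exact: has_derivN. Qed.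

Lemma has_deriv_cst (c : R) : has_deriv (fun _ : R => c) (fun _ => 0).
Proof. by move=> x; exact: is_derive_cst. Qed.

Lemma has_derivZ c f f' : has_deriv f f' -> has_deriv (fun x => c * f x) (fun x => c * f' x).
Proof.
move=> df; apply: has_deriv_eq (has_derivM (has_deriv_cst c) df) _ => x.
by rewrite mul0r add0r.
Qed.

Lemma has_deriv_id : has_deriv (fun x => x) (fun _ => 1).
Proof. by move=> x; exact: is_derive_id. Qed.

Lemma has_deriv_comp f f' g g' : has_deriv f f' -> has_deriv g g' ->
  has_deriv (fun x => f (g x)) (fun x => g' x * f' (g x)).
Proof.
move=> df dg x; apply: is_derive_eq.
  exact: (@is_derive1_comp _ f g x _ _ (df (g x)) (dg x)).
by rewrite mulrC.
Qed.

Lemma has_deriv_continuous f f' : has_deriv f f' -> continuous f.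
Proof.
by move=> df x; apply: differentiable_continuous; apply/derivable1_diffP; case: (df x).
Qed.

(** A function with three successive derivatives, given explicitly to avoid
    iterated derivative operators. *)
Definition chain (u : nat -> R -> R) :=
  forall n, (n < 3)%N -> has_deriv (u n) (u n.+1).

Lemma chain_continuous u n : chain u -> continuous (u 3) -> (n <= 3)%N -> continuous (u n).
Proof.
move=> du cu; rewrite leq_eqVlt => /orP[/eqP -> //|n3].
exact: has_deriv_continuous (du n n3).
Qed.

Definition leibniz (u w : nat -> R -> R) n x : R :=
  match n with
  | 0 => u 0%N x * w 0%N x
  | 1 => u 1%N x * w 0%N x + u 0%N x * w 1%N x
  | 2 => u 2%N x * w 0%N x + (2 * (u 1%N x * w 1%N x) + u 0%N x * w 2%N x)
  | _ => u 3%N x * w 0%N x + (3 * (u 2%N x * w 1%N x) +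
         (3 * (u 1%N x * w 2%N x) + u 0%N x * w 3%N x))
  end.

Lemma chain_leibniz u w : chain u -> chain w -> chain (leibniz u w).
Proof.
move=> du dw.
have [a0 a1 a2] : [/\ has_deriv (u 0%N) (u 1%N), has_deriv (u 1%N) (u 2%N) &
   has_deriv (u 2%N) (u 3%N)] by split; exact: du.
have [b0 b1 b2] : [/\ has_deriv (w 0%N) (w 1%N), has_deriv (w 1%N) (w 2%N) &
   has_deriv (w 2%N) (w 3%N)] by split; exact: dw.
move=> [|[|[|//]]] _; first exact: has_derivM.
- by apply: has_deriv_eq (has_derivD (has_derivM a1 b0) (has_derivM a0 b1)) _ => x /=; ring.
- apply: has_deriv_eq (has_derivD (has_derivM a2 b0)
    (has_derivD (has_derivZ 2 (has_derivM a1 b1)) (has_derivM a0 b2))) _ => x /=; ring.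
Qed.

Lemma has_deriv_cosl l : has_deriv (fun y => cos (l * y)) (fun y => - (l * sin (l * y))).
Proof.
have dc : has_deriv (@cos R) (fun x => - sin x) by move=> x; exact: is_derive_cos.
apply: has_deriv_eq (has_deriv_comp dc (has_derivZ l has_deriv_id)) _ => y; ring.
Qed.

Lemma has_deriv_sinl l : has_deriv (fun y => sin (l * y)) (fun y => l * cos (l * y)).
Proof.
have dc : has_deriv (@sin R) (@cos R) by move=> x; exact: is_derive_sin.
apply: has_deriv_eq (has_deriv_comp dc (has_derivZ l has_deriv_id)) _ => y; ring.
Qed.

End Calculus.

(** * The multiplier |D| on real functions *)

Section Fourier.
Context {R : realType}.
Notation mu := (@lebesgue_measure R).
Implicit Types f g : R -> R.
Implicit Types a b z x y l : R.

Section Oscillatory.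
Variable k : R -> R.
Hypotheses (ck : continuous k) (k1 : forall t, `|k t| <= 1).

Definition osc f l := \int[mu]_y (f y * k (l * y)).

Lemma bdd_osc_kernel l : bdd (fun y => k (l * y)).
Proof.
by split; [move=> x; apply: continuous_comp; [exact: mulrl_continuous|exact: ck]|exists 1].
Qed.

Lemma osc_L1 f l : L1 f -> L1 (fun y => f y * k (l * y)).
Proof. by move=> If; apply: L1Mb => //; exact: bdd_osc_kernel. Qed.

Lemma osc_le f l : L1 f -> `|osc f l| <= \int[mu]_y `|f y|.
Proof.
move=> If; have I1 := osc_L1 l If.
rewrite (le_trans (int_abs I1))//; apply: le_Rintegral => //.
- by case: (L1abs I1).
- by case: (L1abs If).
- by move=> y _; rewrite normrM ler_piMr.
Qed.

Lemma bdd_osc f : L1 f -> bdd (osc f).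
Proof.
move=> If; split; last by exists (\int[mu]_y `|f y|) => l; exact: osc_le.
move=> x.
apply: (@continuity_under_integral R _ _ mu (fun l y => f y * k (l * y)) setT
  measurableT (x - 1) (x + 1) _ _ (fun y => `|f y|)) => //.
- by move=> l _; case: (osc_L1 l If).
- apply: aeW => y _ l _; apply: continuous_mul; first exact: continuous_cst.
  by under eq_fun do rewrite mulrC; case: (bdd_osc_kernel y).
- by case: (L1abs If).
- by move=> l _; apply: aeW => y _; rewrite normrM ler_piMr.
- by rewrite inE/= in_itv/= ltrBlDr ltrDl ltr01.
Qed.

Lemma oscD f g l : L1 f -> L1 g -> osc (fun x => f x + g x) l = osc f l + osc g l.
Proof.
move=> If Ig; rewrite /osc -intD; try exact: osc_L1.
by apply: eq_Rintegral => y _; rewrite mulrDl.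
Qed.

Lemma oscZ c f l : L1 f -> osc (fun x => c * f x) l = c * osc f l.
Proof.
move=> If; rewrite /osc -intZ; last exact: osc_L1.
by apply: eq_Rintegral => y _; rewrite mulrA.
Qed.

(** Fubini for the kernel f x * g l * k (x l), dominated by |f x| |g l|. *)
Lemma osc_sym f g : L1 f -> L1 g ->
  \int[mu]_x (f x * osc g x) = \int[mu]_x (g x * osc f x).
Proof.
move=> If Ig.
pose h (z : R * R) : \bar R := (f z.1 * (g z.2 * k (z.1 * z.2)))%:E.
have mh : measurable_fun setT h.
  apply/measurable_EFinP; apply: measurable_funM.
    by apply: measurableT_comp => //; apply: continuous_measurable_fun; case: If.
  apply: measurable_funM.
    by apply: measurableT_comp => //; apply: continuous_measurable_fun; case: Ig.
  apply: measurableT_comp; first exact: continuous_measurable_fun.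
  by apply: measurable_funM.
have ih : (mu \x mu)%E.-integrable setT h.
  apply/integrable12ltyP => //.
  apply: (@le_lt_trans _ _ (\int[mu]_x (`|f x| * \int[mu]_l `|g l|)%:E)%E).
    apply: ge0_le_integral => //.
    - by move=> x _; apply: integral_ge0 => l _.
    - have mah : measurable_fun setT (abse \o h) by exact: measurableT_comp.
      have := measurable_fun_fubini_tonelli_F (m2 := mu) (abse \o h) mah.
      by move=> H; apply: H => z; exact: abse_ge0.
    - apply/measurable_EFinP/measurable_funM => //.
      by apply: continuous_measurable_fun; case: (L1abs If).
    - move=> x _; rewrite EFinM /Rintegral fineK; last first.
        by apply: integrable_fin_num => //; case: (L1abs Ig).
      rewrite -integralZl//; last by case: (L1abs Ig).
      apply: ge0_le_integral => //.
      + apply: measurableT_comp => //; apply/measurable_EFinP.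
        by have [cgk _] := L1Z (f x) (osc_L1 x Ig); exact: continuous_measurable_fun.
      + apply/measurable_EFinP.
        by have [cgk _] := L1Z `|f x| (L1abs Ig); exact: continuous_measurable_fun.
      + move=> l _ /=; rewrite lee_fin !normrM ler_wpM2l//.
        by rewrite ler_piMr.
  under eq_integral do rewrite mulrC.
  have [_ I1] := L1Z (\int[mu]_l `|g l|) (L1abs If).
  exact: (integrable_lty measurableT I1).
have F := Fubini ih.
transitivity (fine (\int[mu]_x \int[mu]_l h (x, l))%E).
  congr fine; apply: eq_integral => x _.
  rewrite /osc -[(f x * _)%:E](congr1 EFin (intZ (f x) (osc_L1 x Ig))) fineK//.
  by case: (L1Z (f x) (osc_L1 x Ig)) => _; exact: integrable_fin_num.
rewrite F; congr fine; apply: eq_integral => l _.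
rewrite /osc -[(g l * _)%:E](congr1 EFin (intZ (g l) (osc_L1 l If))) fineK; last first.
  by case: (L1Z (g l) (osc_L1 l If)) => _; exact: integrable_fin_num.
by apply: eq_integral => x _; rewrite /h/= mulrCA [x * l]mulrC.
Qed.

End Oscillatory.

Lemma normr_cos_le1 (t : R) : `|cos t| <= 1.
Proof. by rewrite ler_norml cos_geN1 cos_le1. Qed.

Lemma normr_sin_le1 (t : R) : `|sin t| <= 1.
Proof. by rewrite ler_norml sin_geN1 sin_le1. Qed.

(** The Fourier transform of a real function is FC - i FS. *)
Notation FC := (osc (@cos R)).
Notation FS := (osc (@sin R)).

Let cc := @continuous_cos R.
Let cs := @continuous_sin R.
Let c1 := normr_cos_le1.
Let s1 := normr_sin_le1.

(** Integration by parts: (f y cos (l y))' has integral zero. *)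
Lemma FC_deriv f f' l : has_deriv f f' -> L1 f -> L1 f' -> FC f' l = l * FS f l.
Proof.
move=> df If If'; apply/eqP; rewrite -subr_eq0; apply/eqP.
have I1 := osc_L1 cc c1 l If'; have I2 := osc_L1 cs s1 l If.
have I3 := osc_L1 cc c1 l If.
rewrite /osc -intZ// -intB//; last exact: L1Z.
apply: (int_deriv_eq0 (f := fun y => f y * cos (l * y))) => //.
  by apply: has_deriv_eq (has_derivM df (has_deriv_cosl l)) _ => y; ring.
by apply: L1B => //; exact: L1Z.
Qed.

Lemma FS_deriv f f' l : has_deriv f f' -> L1 f -> L1 f' -> FS f' l = - (l * FC f l).
Proof.
move=> df If If'; apply/eqP; rewrite -addr_eq0; apply/eqP.
have I1 := osc_L1 cs s1 l If'; have I2 := osc_L1 cc c1 l If.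
have I3 := osc_L1 cs s1 l If.
rewrite /osc -intZ// -intD//; last exact: L1Z.
apply: (int_deriv_eq0 (f := fun y => f y * sin (l * y))) => //.
  by apply: has_deriv_eq (has_derivM df (has_deriv_sinl l)) _ => y; ring.
by apply: L1D => //; exact: L1Z.
Qed.

(** The Sobolev class W^(3,1), with three continuous derivatives. *)
Definition W31 f := exists2 u : nat -> R -> R, u 0%N = f &
  chain u /\ forall n, (n <= 3)%N -> L1 (u n).

Lemma W31_L1 f : W31 f -> L1 f.
Proof. by move=> [u <- [_ Iu]]; exact: Iu. Qed.

Lemma W31_bdd f : W31 f -> bdd f.
Proof. by move=> [u <- [du Iu]]; apply: L1_bdd (du 0%N isT) (Iu 0%N isT) (Iu 1%N isT). Qed.

Lemma L1_oneDsqrV : L1 (fun l : R => (1 + l ^+ 2)^-1).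
Proof.
have cV : continuous (fun l : R => (1 + l ^+ 2)^-1) by exact: continuous_oneDsqrV.
split => //; apply/integrableP; split.
  by apply/measurable_EFinP; exact: continuous_measurable_fun.
under eq_integral => x _ do rewrite /= ger0_norm ?invr_ge0 ?addr_ge0 ?sqr_ge0//.
rewrite ge0_symfun_integralT//; last 2 first.
- by move=> x; rewrite ?invr_ge0 ?addr_ge0 ?sqr_ge0.
- by move=> x /=; rewrite sqrrN.
rewrite -set_itvcy; have := @integral0y_oneDsqr R; rewrite /oneDsqr => ->.
by rewrite -EFinM ltry.
Qed.

Lemma continuous_normr : continuous (fun l : R => `|l|).
Proof. by move=> l; apply: cvg_norm; exact: cvg_id. Qed.

(** With G either transform, |l| |G l| is bounded by the norm of f' and
    |l|^3 |G l| by that of f'''; adding the two, |l| |G l| (1 + l^2) is bounded. *)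
Lemma W31_decay f : W31 f ->
  L1 (fun l => `|l| * FC f l) /\ L1 (fun l => `|l| * FS f l).
Proof.
move=> [u <- [du Iu]].
have d1 := du 0%N isT; have d2 := du 1%N isT; have d3 := du 2%N isT.
have I0 := Iu 0%N isT; have I1 := Iu 1%N isT; have I2 := Iu 2%N isT; have I3 := Iu 3%N isT.
pose M := \int[mu]_y `|u 1%N y| + \int[mu]_y `|u 3%N y|.
have key (G : R -> R) : continuous G ->
    (forall l, `|l| * `|G l| <= \int[mu]_y `|u 1%N y|) ->
    (forall l, `|l| ^+ 3 * `|G l| <= \int[mu]_y `|u 3%N y|) ->
    L1 (fun l => `|l| * G l).
  move=> cG G1 G3.
  apply: (@L1_le _ _ (fun l => M * (1 + l ^+ 2)^-1)).
  - by apply: continuous_mul => //; exact: continuous_normr.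
  - move=> l; have p : 0 < 1 + l ^+ 2 by rewrite ltr_wpDr// sqr_ge0.
    rewrite ler_pdivlMr// normrM normr_id mulrDr mulr1 lerD//.
    by rewrite -(real_normK (num_real l)) mulrAC -exprS.
  - by case: (L1Z M L1_oneDsqrV).
split; apply: key.
- by case: (bdd_osc cc c1 I0).
- by move=> l; rewrite -normrM -normrN -(FS_deriv l d1 I0 I1) osc_le.
- move=> l; have -> : `|l| ^+ 3 * `|FC (u 0%N) l| = `|FS (u 3%N) l|; last exact: osc_le.
  rewrite (FS_deriv l d3 I2 I3) (FC_deriv l d2 I1 I2) (FS_deriv l d1 I0 I1).
  by rewrite normrN !normrM normrN normrM; ring.
- by case: (bdd_osc cs s1 I0).
- by move=> l; rewrite -normrM -(FC_deriv l d1 I0 I1) osc_le.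
- move=> l; have -> : `|l| ^+ 3 * `|FS (u 0%N) l| = `|FC (u 3%N) l|; last exact: osc_le.
  rewrite (FC_deriv l d3 I2 I3) (FS_deriv l d2 I1 I2) (FC_deriv l d1 I0 I1).
  by rewrite !normrM normrN !normrM; ring.
Qed.

(** The inverse transform of |l| (FC - i FS), whose imaginary part vanishes on real
    functions; see [absD_real]. *)
Definition absDr f x : R := (2 * pi)^-1 *
  (FC (fun l => `|l| * FC f l) x + FS (fun l => `|l| * FS f l) x).

Lemma bdd_absDr f : W31 f -> bdd (absDr f).
Proof.
move=> /W31_decay[IC IS]; apply: bddM; first exact: bddC.
by apply: bddD; exact: bdd_osc.
Qed.

Lemma absDrD f g x : W31 f -> W31 g -> absDr (fun y => f y + g y) x = absDr f x + absDr g x.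
Proof.
move=> Wf Wg.
have [IC IS] := W31_decay Wf; have [JC JS] := W31_decay Wg.
have If := W31_L1 Wf; have Ig := W31_L1 Wg.
have EC : FC (fun l => `|l| * FC (fun y => f y + g y) l) x =
    FC (fun l => `|l| * FC f l) x + FC (fun l => `|l| * FC g l) x.
  rewrite -[RHS](oscD cc c1 x IC JC); apply: eq_Rintegral => l _.
  by rewrite (oscD cc c1 l If Ig) mulrDr.
have ES : FS (fun l => `|l| * FS (fun y => f y + g y) l) x =
    FS (fun l => `|l| * FS f l) x + FS (fun l => `|l| * FS g l) x.
  rewrite -[RHS](oscD cs s1 x IS JS); apply: eq_Rintegral => l _.
  by rewrite (oscD cs s1 l If Ig) mulrDr.
by rewrite /absDr EC ES -mulrDr addrACA.
Qed.

Lemma absDrZ c f x : W31 f -> absDr (fun y => c * f y) x = c * absDr f x.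
Proof.
move=> Wf.
have [IC IS] := W31_decay Wf; have If := W31_L1 Wf.
have EC : FC (fun l => `|l| * FC (fun y => c * f y) l) x =
    c * FC (fun l => `|l| * FC f l) x.
  rewrite -[RHS](oscZ cc c1 c x IC); apply: eq_Rintegral => l _.
  by rewrite (oscZ cc c1 c l If) mulrCA.
have ES : FS (fun l => `|l| * FS (fun y => c * f y) l) x =
    c * FS (fun l => `|l| * FS f l) x.
  rewrite -[RHS](oscZ cs s1 c x IS); apply: eq_Rintegral => l _.
  by rewrite (oscZ cs s1 c l If) mulrCA.
by rewrite /absDr EC ES -mulrDr mulrCA.
Qed.

(** Moving each oscillatory kernel from one factor to the other with [osc_sym]
    exhibits the quadratic form of |D| in frequency space, visibly symmetric. *)
Lemma absDr_form f g : W31 f -> W31 g -> \int[mu]_x (f x * absDr g x) =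
  (2 * pi)^-1 * \int[mu]_l (`|l| * (FC f l * FC g l + FS f l * FS g l)).
Proof.
move=> Wf Wg; have [IC IS] := W31_decay Wg.
have If := W31_L1 Wf.
have bC := bdd_osc cc c1 IC; have bS := bdd_osc cs s1 IS.
have I1 := L1Mb If bC; have I2 := L1Mb If bS.
transitivity (\int[mu]_x ((2 * pi)^-1 * (f x * FC (fun l => `|l| * FC g l) x +
    f x * FS (fun l => `|l| * FS g l) x))).
  by apply: eq_Rintegral => x _; rewrite /absDr; ring.
rewrite intZ; last exact: L1D.
congr (_ * _); rewrite intD// osc_sym// [X in _ + X]osc_sym//.
rewrite -intD.
- by apply: eq_Rintegral => l _; ring.
- by apply: L1Mb => //; exact: bdd_osc.
- by apply: L1Mb => //; exact: bdd_osc.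
Qed.

Lemma absDr_sym f g : W31 f -> W31 g ->
  \int[mu]_x (f x * absDr g x) = \int[mu]_x (g x * absDr f x).
Proof.
move=> Wf Wg; rewrite [LHS](absDr_form Wf Wg) [RHS](absDr_form Wg Wf).
have E : \int[mu]_l (`|l| * (FC f l * FC g l + FS f l * FS g l)) =
    \int[mu]_l (`|l| * (FC g l * FC f l + FS g l * FS f l)).
  by apply: eq_Rintegral => l _; rewrite [FC f l * _]mulrC [FS f l * _]mulrC.
exact: (congr1 (fun z => (2 * pi)^-1 * z) E).
Qed.

Lemma int_odd f : L1 f -> (forall x, f (- x) = - f x) -> \int[mu]_x f x = 0.
Proof.
move=> If odd.
have H n : \int[mu]_(x in `[- n%:R, n%:R]) f x = 0.
  have n0 : - n%:R <= n%:R :> R by rewrite ge0_cp.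
  have := @integration_by_substitution_oppr R f (- n%:R) n%:R n0.
  rewrite opprK => E.
  have {E} /(congr1 fine) E := E (continuous_subspaceT (proj1 If)).
  have : \int[mu]_(x in `[- n%:R, n%:R]) f x = \int[mu]_(x in `[- n%:R, n%:R]) (-1 * f x).
    by rewrite [LHS]E; apply: eq_Rintegral => x _ /=; rewrite odd mulN1r.
  rewrite RintegralZl//; last exact: L1_sub.
  by lra.
have := cvg_int_sym If; under eq_fun do rewrite H.
by move=> /(cvg_unique _ (@cvg_cst R 0 _ \oo _)) <-.
Qed.

End Fourier.

(** * Variation of the energy *)

Section Variation.
Context {R : realType}.
Notation mu := (@lebesgue_measure R).
Implicit Types f g d : R -> R.
Implicit Types a b phi psi : nat -> R -> R.
Implicit Types s x : R.

(** The family a stands for a C^3 function in the Sobolev space H^3 and its first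
    three derivatives. *)
Definition H3 a := chain a /\
  (forall n, (n <= 3)%N -> L2 (a n)).

Lemma H3D a b s : H3 a -> H3 b -> H3 (fun n x => a n x + s * b n x).
Proof.
move=> [da La] [db Lb]; split => n n3.
  by apply: has_derivD; [exact: da|apply: has_derivZ; exact: db].
by apply: L2D; [exact: La|apply: L2Z; exact: Lb].
Qed.

(** The square of a n is integrable with its derivative, so [L1_bdd] bounds it. *)
Lemma H3_bdd a n : H3 a -> (n < 3)%N -> bdd (a n).
Proof.
move=> [da La] n3.
have L0 := La n (ltnW n3); have L1' := La n.+1 n3.
split; first by case: L0.
have dsq : has_deriv (fun x => a n x * a n x)
    (fun x => a n.+1 x * a n x + a n x * a n.+1 x) by apply: has_derivM; exact: da.
have [_ [M aM]] := L1_bdd dsq (proj1 L0) (L1D (L2M L1' L0) (L2M L0 L1')).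
exists (1 + M) => x; have := aM x; rewrite ler_norml => /andP[_ h].
have := sqr_ge0 (a n x); have := sqr_ge0 (a n x - 1); have := sqr_ge0 (a n x + 1).
by rewrite ler_norml; nra.
Qed.

Lemma H3_mul a b : H3 a -> H3 b -> W31 (fun x => a 0%N x * b 0%N x).
Proof.
move=> [da La] [db Lb]; exists (leibniz a b) => //; split; first exact: chain_leibniz.
have P i j : (i <= 3)%N -> (j <= 3)%N -> L1 (fun x => a i x * b j x).
  by move=> i3 j3; apply: L2M; [exact: La|exact: Lb].
by move=> [|[|[|n]]] _; repeat (first [exact: P|apply: L1D|apply: L1Z]).
Qed.

Lemma W31D f g : W31 f -> W31 g -> W31 (fun x => f x + g x).
Proof.
move=> [u <- [du Iu]] [w <- [dw Iw]]; exists (fun n x => u n x + w n x) => //.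
split=> n n3; first by apply: has_derivD; [exact: du|exact: dw].
by apply: L1D; [exact: Iu|exact: Iw].
Qed.

Lemma W31Z c f : W31 f -> W31 (fun x => c * f x).
Proof.
move=> [u <- [du Iu]]; exists (fun n x => c * u n x) => //.
by split=> n n3; [apply: has_derivZ; exact: du|apply: L1Z; exact: Iu].
Qed.

(** A family of integrands that is a quartic polynomial in s, with integrable
    coefficients; d is the coefficient of s. The Horner form makes both integration
    and differentiation in s a sequence of elementary steps. *)
Definition quartic (J : R -> R -> R) d := L1 d /\
  exists c0 c2 c3 c4, [/\ L1 c0, L1 c2, L1 c3 & L1 c4] /\
  forall s x, J s x = c0 x + s * (d x + s * (c2 x + s * (c3 x + s * c4 x))).

Lemma quartic_ext J J' d d' : quartic J d -> (forall s x, J' s x = J s x) ->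
  d =1 d' -> quartic J' d'.
Proof.
move=> [Id [c0 [c2 [c3 [c4 [Ic JE]]]]]] JJ /funext <-; split => //.
by exists c0, c2, c3, c4; split => // s x; rewrite JJ.
Qed.

Lemma quarticD J J' d d' : quartic J d -> quartic J' d' ->
  quartic (fun s x => J s x + J' s x) (fun x => d x + d' x).
Proof.
move=> [Id [c0 [c2 [c3 [c4 [[? ? ? ?] JE]]]]]] [Id' [c0' [c2' [c3' [c4' [[? ? ? ?] JE']]]]]].
split; first exact: L1D.
exists (fun x => c0 x + c0' x), (fun x => c2 x + c2' x), (fun x => c3 x + c3' x),
  (fun x => c4 x + c4' x); split; first by split; exact: L1D.
by move=> s x; rewrite JE JE'; ring.
Qed.

Lemma quarticZ c J d : quartic J d -> quartic (fun s x => c * J s x) (fun x => c * d x).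
Proof.
move=> [Id [c0 [c2 [c3 [c4 [[? ? ? ?] JE]]]]]]; split; first exact: L1Z.
exists (fun x => c * c0 x), (fun x => c * c2 x), (fun x => c * c3 x), (fun x => c * c4 x).
by split; [split; exact: L1Z|move=> s x; rewrite JE; ring].
Qed.

(** P and Q are the classes that the factors range over: L2 against L2 for the
    quadratic terms of the energy, L1 against bounded for the quartic ones. *)
Lemma quarticM (P Q : (R -> R) -> Prop) f0 f1 f2 g0 g1 g2 :
  (forall f g, P f -> Q g -> L1 (fun x => f x * g x)) ->
  [/\ P f0, P f1 & P f2] -> [/\ Q g0, Q g1 & Q g2] ->
  quartic (fun s x => (f0 x + s * f1 x + s ^+ 2 * f2 x) *
                      (g0 x + s * g1 x + s ^+ 2 * g2 x))
          (fun x => f0 x * g1 x + f1 x * g0 x).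
Proof.
move=> PQ [P0 P1 P2] [Q0 Q1 Q2]; split; first by apply: L1D; exact: PQ.
exists (fun x => f0 x * g0 x), (fun x => f0 x * g2 x + (f1 x * g1 x + f2 x * g0 x)),
  (fun x => f1 x * g2 x + f2 x * g1 x), (fun x => f2 x * g2 x).
by split; [split; repeat (first [exact: PQ|apply: L1D])|move=> s x; ring].
Qed.

Lemma quartic_derive J d : quartic J d ->
  is_derive (0 : R) (1 : R) (fun s => \int[mu]_x J s x) (\int[mu]_x d x).
Proof.
move=> [Id [c0 [c2 [c3 [c4 [[I0 I2 I3 I4] JE]]]]]].
pose k f := \int[mu]_x f x.
have -> : (fun s => \int[mu]_x J s x) =
    fun s => k c0 + s * (k d + s * (k c2 + s * (k c3 + s * k c4))).
  apply/funext => s; rewrite /k.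
  have J4 := L1Z s I4; have J3 := L1Z s (L1D I3 J4).
  have J2 := L1Z s (L1D I2 J3); have J1 := L1Z s (L1D Id J2).
  under eq_Rintegral => x _ do rewrite JE.
  rewrite (intD I0 J1) (intZ s (L1D Id J2)) (intD Id J2) (intZ s (L1D I2 J3)).
  by rewrite (intD I2 J3) (intZ s (L1D I3 J4)) (intD I3 J4) (intZ s I4).
have horner c f f' : has_deriv f f' ->
    has_deriv (fun s => c + s * f s) (fun s => 0 + (1 * f s + s * f' s)).
  by move=> df; exact: has_derivD (has_deriv_cst c) (has_derivM (@has_deriv_id R) df).
have H := horner (k c0) _ _ (horner (k d) _ _ (horner (k c2) _ _ (horner (k c3) _ _
  (has_deriv_cst (k c4))))).
apply: (is_derive_eq (H 0)).
by rewrite /k !mul0r; ring.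
Qed.

(* The coefficients of the seven terms of the energy density. *)
Variables e0 e1 e2 e3 e4 e5 e6 : R.

Definition sqmod a b x := a 0%N x * a 0%N x + b 0%N x * b 0%N x.
(** The momentum density Im (conj v * v') of v = a + i b. *)
Definition current a b x := a 0%N x * b 1%N x - b 0%N x * a 1%N x.

Definition density a b x : R :=
  e0 * sqmod a b x + e1 * current a b x
  + e2 * (a 1%N x * a 1%N x + b 1%N x * b 1%N x)
  + e3 * (sqmod a b x * sqmod a b x)
  - e4 * (a 0%N x * b 3%N x - b 0%N x * a 3%N x)
  + e5 * (sqmod a b x * current a b x)
  - e6 * (sqmod a b x * absDr (sqmod a b) x).

(** Real and imaginary parts of the derivative of the energy with respect to the
    conjugate of v = a + i b, that is of
      e0 v - i e1 v' - e2 v'' + 2 e3 |v|^2 v + i e4 v''' - 2 i e5 |v|^2 v'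
      - 2 e6 v |D||v|^2. *)
Definition grad_re a b x : R :=
  e0 * a 0%N x + e1 * b 1%N x - e2 * a 2%N x + 2 * e3 * (sqmod a b x * a 0%N x)
  - e4 * b 3%N x + 2 * e5 * (sqmod a b x * b 1%N x)
  - 2 * e6 * (absDr (sqmod a b) x * a 0%N x).

Definition grad_im a b x : R :=
  e0 * b 0%N x - e1 * a 1%N x - e2 * b 2%N x + 2 * e3 * (sqmod a b x * b 0%N x)
  + e4 * a 3%N x - 2 * e5 * (sqmod a b x * a 1%N x)
  - 2 * e6 * (absDr (sqmod a b) x * b 0%N x).

Lemma sqmod_W31 a b : H3 a -> H3 b -> W31 (sqmod a b).
Proof. by move=> Ha Hb; apply: W31D; exact: H3_mul. Qed.

Section FirstVariation.
Variables a b phi psi : nat -> R -> R.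
Hypotheses (Ha : H3 a) (Hb : H3 b) (Hphi : H3 phi) (Hpsi : H3 psi).

Let sqmod1 x := 2 * (a 0%N x * phi 0%N x + b 0%N x * psi 0%N x).
Let as_ s n x := a n x + s * phi n x.
Let bs_ s n x := b n x + s * psi n x.

(* The coefficient of s in the density at v + s h. *)
Let dvar x : R :=
  e0 * sqmod1 x
  + e1 * (a 0%N x * psi 1%N x + phi 0%N x * b 1%N x - (b 0%N x * phi 1%N x + psi 0%N x * a 1%N x))
  + e2 * (2 * (a 1%N x * phi 1%N x + b 1%N x * psi 1%N x))
  + e3 * (2 * (sqmod a b x * sqmod1 x))
  - e4 * (a 0%N x * psi 3%N x + phi 0%N x * b 3%N x - (b 0%N x * phi 3%N x + psi 0%N x * a 3%N x))
  + e5 * (sqmod a b x * (a 0%N x * psi 1%N x + phi 0%N x * b 1%N x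
                         - (b 0%N x * phi 1%N x + psi 0%N x * a 1%N x))
         + sqmod1 x * current a b x)
  - e6 * (sqmod a b x * absDr sqmod1 x + sqmod1 x * absDr (sqmod a b) x).

(* Generalizing the values at x lets ring work on variables only. *)
Ltac generic_entries x :=
  move: (a 0%N x) (a 1%N x) (a 2%N x) (a 3%N x) (b 0%N x) (b 1%N x) (b 2%N x)
    (b 3%N x) (phi 0%N x) (phi 1%N x) (phi 2%N x) (phi 3%N x)
    (psi 0%N x) (psi 1%N x) (psi 2%N x) (psi 3%N x) => *.

Lemma sqmod1_W31 : W31 sqmod1.
Proof. by apply: W31Z; apply: W31D; exact: H3_mul. Qed.

Lemma sqmod_s s x :
  sqmod (as_ s) (bs_ s) x = sqmod a b x + s * sqmod1 x + s ^+ 2 * sqmod phi psi x.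
Proof. rewrite /sqmod /as_ /bs_ /sqmod1; ring. Qed.

Lemma absDr_sqmod_s s x : absDr (sqmod (as_ s) (bs_ s)) x =
  absDr (sqmod a b) x + s * absDr sqmod1 x + s ^+ 2 * absDr (sqmod phi psi) x.
Proof.
have W0 := sqmod_W31 Ha Hb; have W1 := sqmod1_W31; have W2 := sqmod_W31 Hphi Hpsi.
have -> : sqmod (as_ s) (bs_ s) =
    fun x => (sqmod a b x + s * sqmod1 x) + s ^+ 2 * sqmod phi psi x.
  by apply/funext => y; exact: sqmod_s.
have W1s := W31Z s W1.
by rewrite (absDrD _ (W31D W0 W1s) (W31Z _ W2)) (absDrD _ W0 W1s) (absDrZ _ _ W1)
  (absDrZ _ _ W2).
Qed.

Lemma density_quartic :
  quartic (fun s => density (as_ s) (bs_ s)) dvar.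
Proof.
have lin a' phi' b' psi' i j : H3 a' -> H3 phi' -> H3 b' -> H3 psi' ->
    (i <= 3)%N -> (j <= 3)%N ->
    quartic (fun s x => (a' i x + s * phi' i x) * (b' j x + s * psi' j x))
            (fun x => a' i x * psi' j x + phi' i x * b' j x).
  move=> [_ La] [_ Lphi] [_ Lb] [_ Lpsi] i3 j3.
  apply: quartic_ext (@quarticM L2 L2 (a' i) (phi' i) (fun=> 0) (b' j) (psi' j) (fun=> 0)
     (fun f g => @L2M R f g) _ _) _ _.
  - by split; [exact: La|exact: Lphi|exact: L2_0].
  - by split; [exact: Lb|exact: Lpsi|exact: L2_0].
  - by move=> s x; ring.
  - by [].
have W0 := sqmod_W31 Ha Hb; have W1 := sqmod1_W31; have W2 := sqmod_W31 Hphi Hpsi.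
have Lr : [/\ L1 (sqmod a b), L1 sqmod1 & L1 (sqmod phi psi)] by split; exact: W31_L1.
have Br : [/\ bdd (sqmod a b), bdd sqmod1 & bdd (sqmod phi psi)] by split; exact: W31_bdd.
have BA : [/\ bdd (absDr (sqmod a b)), bdd (absDr sqmod1) & bdd (absDr (sqmod phi psi))].
  by split; exact: bdd_absDr.
have Bm a' b' i j : H3 a' -> H3 b' -> (i < 3)%N -> (j < 3)%N -> bdd (fun x => a' i x * b' j x).
  by move=> Ha' Hb' i3 j3; apply: bddM; exact: H3_bdd.
have Bc : [/\ bdd (current a b),
    bdd (fun x => a 0%N x * psi 1%N x + phi 0%N x * b 1%N x -
       (b 0%N x * phi 1%N x + psi 0%N x * a 1%N x)) & bdd (current phi psi)].
  by split; repeat (first [exact: Bm|apply: bddB|apply: bddD]).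
have M := @quarticM (@L1 R) bdd _ _ _ _ _ _ (fun f g => @L1Mb R f g) Lr.
have T0 := quarticZ e0 (quarticD (lin a phi a phi 0%N 0%N Ha Hphi Ha Hphi isT isT)
                            (lin b psi b psi 0%N 0%N Hb Hpsi Hb Hpsi isT isT)).
have T1 := quarticZ e1 (quarticD (lin a phi b psi 0%N 1%N Ha Hphi Hb Hpsi isT isT)
                (quarticZ (-1) (lin b psi a phi 0%N 1%N Hb Hpsi Ha Hphi isT isT))).
have T2 := quarticZ e2 (quarticD (lin a phi a phi 1%N 1%N Ha Hphi Ha Hphi isT isT)
                            (lin b psi b psi 1%N 1%N Hb Hpsi Hb Hpsi isT isT)).
have T3 := quarticZ e3 (M _ _ _ Br).
have T4 := quarticZ (- e4) (quarticD (lin a phi b psi 0%N 3%N Ha Hphi Hb Hpsi isT isT)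
                (quarticZ (-1) (lin b psi a phi 0%N 3%N Hb Hpsi Ha Hphi isT isT))).
have T5 := quarticZ e5 (M _ _ _ Bc).
have T6 := quarticZ (- e6) (M _ _ _ BA).
apply: quartic_ext (quarticD (quarticD (quarticD (quarticD (quarticD (quarticD
   T0 T1) T2) T3) T4) T5) T6) _ _.
  move=> s x.
  have Ecur : current (as_ s) (bs_ s) x = current a b x + s * (a 0%N x * psi 1%N x +
     phi 0%N x * b 1%N x - (b 0%N x * phi 1%N x + psi 0%N x * a 1%N x)) +
     s ^+ 2 * current phi psi x by rewrite /current /as_ /bs_; ring.
  by rewrite -sqmod_s -absDr_sqmod_s -Ecur !mulN1r !mulNr.
move=> x; rewrite /dvar; move: (absDr _ x) (absDr _ x) => A0 A1.
by rewrite /sqmod1 /current /sqmod; generic_entries x; ring.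
Qed.

Lemma grad_re_L2 : L2 (grad_re a b).
Proof.
have [[_ La] [_ Lb]] := (Ha, Hb).
have W0 := sqmod_W31 Ha Hb; have B0 := W31_bdd W0; have A0 := bdd_absDr W0.
apply: L2B; last by apply: L2Z; apply: L2bM => //; exact: La.
apply: L2D; last by apply: L2Z; apply: L2bM => //; exact: Lb.
apply: L2B; last by apply: L2Z; exact: Lb.
apply: L2D; last by apply: L2Z; apply: L2bM => //; exact: La.
apply: L2B; last by apply: L2Z; exact: La.
by apply: L2D; apply: L2Z; [exact: La|exact: Lb].
Qed.

Lemma grad_im_L2 : L2 (grad_im a b).
Proof.
have [[_ La] [_ Lb]] := (Ha, Hb).
have W0 := sqmod_W31 Ha Hb; have B0 := W31_bdd W0; have A0 := bdd_absDr W0.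
apply: L2B; last by apply: L2Z; apply: L2bM => //; exact: Lb.
apply: L2B; last by apply: L2Z; apply: L2bM => //; exact: La.
apply: L2D; last by apply: L2Z; exact: La.
apply: L2D; last by apply: L2Z; apply: L2bM => //; exact: Lb.
apply: L2B; last by apply: L2Z; exact: Lb.
by apply: L2B; apply: L2Z; [exact: Lb|exact: La].
Qed.

(* The boundary terms produced by moving all derivatives from h to v. *)
Let flux x : R :=
  e1 * (a 0%N x * psi 0%N x - b 0%N x * phi 0%N x)
  + 2 * e2 * (a 1%N x * phi 0%N x + b 1%N x * psi 0%N x)
  - e4 * (a 0%N x * psi 2%N x - a 1%N x * psi 1%N x + a 2%N x * psi 0%N x
          - (b 0%N x * phi 2%N x - b 1%N x * phi 1%N x + b 2%N x * phi 0%N x))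
  + e5 * (sqmod a b x * (a 0%N x * psi 0%N x - b 0%N x * phi 0%N x)).

Let flux' x : R :=
  e1 * (a 1%N x * psi 0%N x + a 0%N x * psi 1%N x
        - (b 1%N x * phi 0%N x + b 0%N x * phi 1%N x))
  + 2 * e2 * (a 2%N x * phi 0%N x + a 1%N x * phi 1%N x
        + (b 2%N x * psi 0%N x + b 1%N x * psi 1%N x))
  - e4 * (a 0%N x * psi 3%N x + a 3%N x * psi 0%N x
          - (b 0%N x * phi 3%N x + b 3%N x * phi 0%N x))
  + e5 * ((2 * (a 0%N x * a 1%N x + b 0%N x * b 1%N x)) *
             (a 0%N x * psi 0%N x - b 0%N x * phi 0%N x)
          + sqmod a b x * (a 1%N x * psi 0%N x + a 0%N x * psi 1%N x
             - (b 1%N x * phi 0%N x + b 0%N x * phi 1%N x))).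

(** In the third-order term the products of a first with a second derivative cancel
    in pairs. *)
Lemma flux_derive : has_deriv flux flux'.
Proof.
have [a0 a1 a2] : [/\ has_deriv (a 0%N) (a 1%N), has_deriv (a 1%N) (a 2%N) &
   has_deriv (a 2%N) (a 3%N)] by case: Ha => da _; split; exact: da.
have [b0 b1 b2] : [/\ has_deriv (b 0%N) (b 1%N), has_deriv (b 1%N) (b 2%N) &
   has_deriv (b 2%N) (b 3%N)] by case: Hb => da _; split; exact: da.
have [f0 f1 f2] : [/\ has_deriv (phi 0%N) (phi 1%N), has_deriv (phi 1%N) (phi 2%N) &
   has_deriv (phi 2%N) (phi 3%N)] by case: Hphi => da _; split; exact: da.
have [p0 p1 p2] : [/\ has_deriv (psi 0%N) (psi 1%N), has_deriv (psi 1%N) (psi 2%N) &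
   has_deriv (psi 2%N) (psi 3%N)] by case: Hpsi => da _; split; exact: da.
apply: has_deriv_eq.
  apply: has_derivD; last first.
    apply: has_derivZ; apply: has_derivM.
      by apply: has_derivD; apply: has_derivM; eassumption.
    by apply: has_derivB; apply: has_derivM; eassumption.
  apply: has_derivB; last first.
    apply: has_derivZ; apply: has_derivB.
      by apply: has_derivD; [apply: has_derivB|]; apply: has_derivM; eassumption.
    by apply: has_derivD; [apply: has_derivB|]; apply: has_derivM; eassumption.
  apply: has_derivD.
    by apply: has_derivZ; apply: has_derivB; apply: has_derivM; eassumption.
  by apply: has_derivZ; apply: has_derivD; apply: has_derivM; eassumption.
by move=> x; rewrite /flux' /sqmod; ring.
Qed.

Lemma int_flux : L1 flux' /\ \int[mu]_x flux' x = 0.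
Proof.
have B0 := W31_bdd (sqmod_W31 Ha Hb).
have P a' b' i j : H3 a' -> H3 b' -> (i <= 3)%N -> (j <= 3)%N -> L1 (fun x => a' i x * b' j x).
  by move=> [_ La] [_ Lb] i3 j3; apply: L2M; [exact: La|exact: Lb].
have B a' b' i j : H3 a' -> H3 b' -> (i < 3)%N -> (j < 3)%N -> bdd (fun x => a' i x * b' j x).
  by move=> Ha' Hb' i3 j3; apply: bddM; exact: H3_bdd.
have If : L1 flux.
  by repeat (first [exact: P|apply: L1D|apply: L1N|apply: L1Z|apply: (L1bM B0)]).
have If' : L1 flux'.
  apply: L1D.
    by repeat (first [exact: P|apply: L1D|apply: L1N|apply: L1Z]).
  apply: L1Z; apply: L1D.
    apply: L1Mb; first by apply: L1Z; apply: L1D; exact: P.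
    by apply: bddB; exact: B.
  by apply: L1bM => //; repeat (first [exact: P|apply: L1D|apply: L1N]).
by split => //; exact: int_deriv_eq0 flux_derive If If'.
Qed.

(** The coefficient of s differs from 2 (grad_re phi + grad_im psi) by [flux'] and by
    e6 (f |D|g - g |D|f), with g the density |v|^2 and f its first-order variation;
    both have integral zero. *)
Lemma first_variation :
  is_derive (0 : R) (1 : R) (fun s => \int[mu]_x density (as_ s) (bs_ s) x)
   (\int[mu]_x (2 * (grad_re a b x * phi 0%N x + grad_im a b x * psi 0%N x))).
Proof.
apply: (is_derive_eq (quartic_derive density_quartic)).
have [_ Lphi] := Hphi; have [_ Lpsi] := Hpsi.
have Iq : L1 (fun x => 2 * (grad_re a b x * phi 0%N x + grad_im a b x * psi 0%N x)).
  by apply: L1Z; apply: L1D; apply: L2M;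
    [exact: grad_re_L2|exact: Lphi|exact: grad_im_L2|exact: Lpsi].
have [If' int0] := int_flux.
have W0 := sqmod_W31 Ha Hb; have W1 := sqmod1_W31.
have I1 : L1 (fun x => sqmod1 x * absDr (sqmod a b) x).
  by apply: L1Mb; [exact: W31_L1|exact: bdd_absDr].
have I2 : L1 (fun x => sqmod a b x * absDr sqmod1 x).
  by apply: L1Mb; [exact: W31_L1|exact: bdd_absDr].
(* Coefficient of s = gradient term + flux' + symmetric difference, pointwise. *)
transitivity (\int[mu]_x ((2 * (grad_re a b x * phi 0%N x + grad_im a b x * psi 0%N x) + flux' x)
   + e6 * (sqmod1 x * absDr (sqmod a b) x - sqmod a b x * absDr sqmod1 x))).
  apply: eq_Rintegral => x _.
  rewrite /dvar /grad_re /grad_im /flux'; move: (absDr _ x) (absDr _ x) => A0 A1.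
  by rewrite /sqmod1 /current /sqmod; generic_entries x; ring.
have E0 := intD (L1D Iq If') (L1Z e6 (L1B I1 I2)).
have E1 := intZ e6 (L1B I1 I2); have E2 := intB I1 I2.
rewrite [LHS]E0 [X in X + _](intD Iq If') int0 addr0.
rewrite [X in _ + X]E1 [X in _ * X]E2 [X in X - _](absDr_sym W1 W0).
by rewrite subrr mulr0 addr0.
Qed.
End FirstVariation.
End Variation.

(** * The fundamental lemma of the calculus of variations *)

Section Bump.
Context {R : realType}.
Notation mu := (@lebesgue_measure R).
Implicit Types f g : R -> R.
Implicit Types a b x y : R.

(** At the origin the difference quotient is |h|. All other derivatives of the cutoff
    follow from this one by the rules of calculus. *)
Lemma has_deriv_mul_norm : has_deriv (fun y : R => y * `|y|) (fun y => 2 * `|y|).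
Proof.
move=> x; have [x0|x0|->] := ltgtP x 0.
- apply: (@near_eq_is_derive R R R (fun y => - (y * y))).
    near=> z; rewrite ltr0_norm ?mulrN//; near: z; exact: lt_nbhsl.
  have H := has_derivN (has_derivM (@has_deriv_id R) (@has_deriv_id R)).
  by apply: (is_derive_eq (H x)); rewrite ltr0_norm//; ring.
- apply: (@near_eq_is_derive R R R (fun y => y * y)).
    near=> z; rewrite gtr0_norm//; near: z; exact: lt_nbhsr.
  have H := has_derivM (@has_deriv_id R) (@has_deriv_id R).
  by apply: (is_derive_eq (H x)); rewrite gtr0_norm//; ring.
- have H : (fun h : R => h^-1 *: ((fun y => y * `|y|) (h *: (1 : R) + 0) - (fun y => y * `|y|) 0))
     @ 0^' --> (0 : R).
    apply: cvg_trans (_ : (fun h : R => `|h|) @ 0^' --> (0 : R)).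
      apply: near_eq_cvg; near=> h.
      have h0 : h != 0 by near: h; exact: nbhs_dnbhs_neq.
      by rewrite /= addr0 mul0r subr0 [h *: 1]mulr1 [_ *: _]mulrA mulVf// mul1r.
    rewrite -[X in _ --> X](normr0 R); apply: cvg_norm.
    exact: cvg_within.
  rewrite normr0 mulr0; split; first by apply/cvg_ex; exists 0; exact: H.
  exact: (cvg_lim _ H).
Unshelve. all: by end_near. Qed.

Definition pospart (y : R) : R := (y + `|y|) / 2.

Lemma pospartE y : pospart y = if 0 <= y then y else 0.
Proof. by rewrite /pospart; case: leP => y0; [rewrite ger0_norm|rewrite ltr0_norm]; lra. Qed.

Lemma mul_pospart y : y * pospart y = pospart y * pospart y.
Proof. by rewrite pospartE; case: ifP => _; ring. Qed.

Lemma continuous_pospart : continuous pospart.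
Proof.
move=> y; apply: cvgM; last exact: cvg_cst.
by apply: cvgD; [exact: cvg_id|apply: cvg_norm; exact: cvg_id].
Qed.

Lemma has_deriv_pospart2 : has_deriv (fun y => pospart y ^+ 2) (fun y => 2 * pospart y).
Proof.
have -> : (fun y => pospart y ^+ 2) = fun y => 2^-1 * (y * y + y * `|y|).
  apply/funext => y; rewrite expr2 -mul_pospart /pospart; ring.
apply: has_deriv_eq (has_derivZ 2^-1 (has_derivD (has_derivM (@has_deriv_id R)
  (@has_deriv_id R)) has_deriv_mul_norm)) _ => y.
rewrite /pospart; ring.
Qed.

(** By induction, as the n+3 power is y times the n+2 power ([mul_pospart]). *)
Lemma has_deriv_pospartX n : has_deriv (fun y => pospart y ^+ n.+2)
  (fun y => n.+2%:R * pospart y ^+ n.+1).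
Proof.
elim: n => [|n IH]; first exact: has_deriv_pospart2.
have -> : (fun y => pospart y ^+ n.+3) = fun y => y * pospart y ^+ n.+2.
  by apply/funext => y; rewrite [pospart y ^+ n.+2]exprS mulrA mul_pospart -mulrA -!exprS.
apply: has_deriv_eq (has_derivM (@has_deriv_id R) IH) _ => y.
have e : y * pospart y ^+ n.+1 = pospart y ^+ n.+2.
  by rewrite exprS mulrA mul_pospart -mulrA -!exprS.
have n3 : n.+3%:R = 1 + n.+2%:R :> R by rewrite addrC natr1.
rewrite n3; move: (n.+2%:R : R) (pospart y ^+ n.+2) (pospart y ^+ n.+1) e => N P2 P1 <-.
ring.
Qed.

Lemma L1_support f a b : continuous f -> (forall x, (x < a) || (b < x) -> f x = 0) -> L1 f.
Proof.
move=> cf f0; split => //.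
have -> : EFin \o f = (EFin \o f) \_ `[a, b].
  apply/funext => x; rewrite patchE; case: ifPn => //=.
  rewrite notin_setE/= in_itv/= => /negP; rewrite negb_and -!ltNge => /f0 ->//.
apply: (iffLR (integrable_mkcond _ _)) => //.
apply: continuous_compact_integrable; first exact: segment_compact.
exact: continuous_subspaceT.
Qed.

Lemma leibniz0 u w n x : (forall m, u m x = 0) \/ (forall m, w m x = 0) ->
  leibniz u w n x = 0.
Proof. by move=> [] h; case: n => [|[|[|n]]] /=; rewrite !h; ring. Qed.

(** The fourth power, the lowest with a continuous third derivative, and its first
    three derivatives; the sign of c chooses the side of a where it is positive. *)
Definition ramp (c a : R) n x : R :=
  match n with
  | 0 => pospart (c * (x - a)) ^+ 4
  | 1 => c * (4 * pospart (c * (x - a)) ^+ 3)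
  | 2 => c * (4 * (c * (3 * pospart (c * (x - a)) ^+ 2)))
  | _ => c * (4 * (c * (3 * (c * (2 * pospart (c * (x - a)))))))
  end.

Lemma has_deriv_affine c a : has_deriv (fun x => c * (x - a)) (fun=> c).
Proof.
apply: has_deriv_eq (has_derivZ c (has_derivB (@has_deriv_id R) (has_deriv_cst a))) _ => x.
by rewrite subr0 mulr1.
Qed.

Lemma chain_ramp c a : chain (ramp c a).
Proof.
have dl := has_deriv_affine c a; have D n := has_deriv_comp (has_deriv_pospartX n) dl.
move=> [|[|[|//]]] _.
- exact: (D 2%N).
- exact: (has_derivZ c (has_derivZ 4 (D 1%N))).
- exact: (has_derivZ c (has_derivZ 4 (has_derivZ c (has_derivZ 3
    (has_deriv_comp has_deriv_pospart2 dl))))).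
Qed.

Lemma continuous_ramp c a n : (n <= 3)%N -> continuous (ramp c a n).
Proof.
apply: (chain_continuous (@chain_ramp c a)) => x.
have cp : continuous (fun x => pospart (c * (x - a))).
  move=> y; apply: (@continuous_comp _ _ _ (fun x => c * (x - a)) pospart).
    exact: has_deriv_continuous (has_deriv_affine c a) _.
  exact: continuous_pospart.
by rewrite /ramp; repeat (apply: continuous_mul; first exact: continuous_cst).
Qed.

Lemma ramp0 c a n x : c * (x - a) <= 0 -> ramp c a n x = 0.
Proof.
move=> h; have p0 : pospart (c * (x - a)) = 0.
  by rewrite pospartE; case: ifP => // h'; apply/eqP; rewrite eq_le h h'.
by case: n => [|[|[|n]]] /=; rewrite p0 ?expr0n/=; ring.
Qed.

Definition cutoff a b := leibniz (ramp 1 a) (ramp (-1) b).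

Lemma cutoff_out a b n x : (x <= a) || (b <= x) -> cutoff a b n x = 0.
Proof.
move=> /orP[xa|bx]; apply: leibniz0; [left|right] => m; apply: ramp0; lra.
Qed.

Lemma cutoff_gt0 a b x : a < x < b -> 0 < cutoff a b 0 x.
Proof.
move=> /andP[ax xb]; apply: mulr_gt0; rewrite /ramp exprn_gt0// pospartE ifT; lra.
Qed.

Lemma cutoff_ge0 a b x : 0 <= cutoff a b 0 x.
Proof.
have [xa|ax] := leP x a; first by rewrite cutoff_out// xa.
have [bx|xb] := leP b x; first by rewrite cutoff_out// bx orbT.
by rewrite ltW// cutoff_gt0// ax.
Qed.

Lemma cutoff_H3 a b : H3 (cutoff a b).
Proof.
have C : chain (cutoff a b) by apply: chain_leibniz; exact: chain_ramp.
have cC n : (n <= 3)%N -> continuous (cutoff a b n).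
  apply: chain_continuous C _; rewrite /cutoff /leibniz.
  by repeat (first [exact: continuous_ramp|exact: continuous_cst|apply: continuous_add
    |apply: continuous_mul]).
split=> // n n3; split; last exact: cC.
apply: (@L1_support _ a b); first by apply: continuous_mul; exact: cC.
by move=> x h; rewrite cutoff_out ?mul0r//; case/orP: h => /ltW ->//; rewrite orbT.
Qed.

Lemma int_eq0 f x : L1 f -> (forall y, 0 <= f y) -> \int[mu]_y f y = 0 -> f x = 0.
Proof.
move=> If f0 I0; apply/eqP; rewrite eq_le f0 andbT leNgt; apply/negP => fx.
have cf : continuous f by case: If.
have fx2 : f x / 2 < f x by lra.
have /nbhs_ballP[e /= e0 He] : \forall y \near x, f x / 2 < f y.
  exact: (cvgr_gt _ (cf x)).
pose A : set R := `[x - e / 2, x + e / 2].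
have ab : x - e / 2 < x + e / 2 by lra.
have mA : mu A = e%:E.
  rewrite lebesgue_measure_itv/= lte_fin ab -EFinB; congr EFin; lra.
have : \int[mu]_(y in A) (f x / 2) <= \int[mu]_(y in A) f y.
  apply: le_Rintegral.
  - exact: measurable_itv.
  - apply: continuous_compact_integrable; first exact: segment_compact.
    by apply: continuous_subspaceT; exact: continuous_cst.
  - by apply: L1_sub => //; exact: measurable_itv.
  - move=> y; rewrite /A/= in_itv/= => /andP[h1 h2]; apply/ltW/He.
    by rewrite /ball/= ltr_norml; apply/andP; split; lra.
have -> : \int[mu]_(y in A) (f x / 2) = f x / 2 * e.
  rewrite Rintegral_cst; last exact: measurable_itv.
  by congr (_ * _); exact: (congr1 fine mA).
have : \int[mu]_(y in A) f y <= \int[mu]_y f y.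
  by apply: int_sub_le => //; exact: measurable_itv.
by rewrite I0; nra.
Qed.

(** Where f exceeds g at x, it does so on an interval around x; the cutoff
    of that interval makes (f - g) * cutoff nonnegative and positive at x, so its
    integral is not zero ([int_eq0]). *)
Lemma fundamental_lemma f g : continuous f -> continuous g ->
  (forall a b, \int[mu]_x (f x * cutoff a b 0 x) = \int[mu]_x (g x * cutoff a b 0 x)) ->
  f = g.
Proof.
move=> cf cg H.
have Ib (h : R -> R) a b : continuous h -> L1 (fun x => h x * cutoff a b 0 x).
  move=> ch; apply: (@L1_support _ a b).
    by apply: continuous_mul => //; have [_ L] := cutoff_H3 a b; case: (L 0%N isT).
  by move=> x h'; rewrite cutoff_out ?mulr0//; case/orP: h' => /ltW ->//; rewrite orbT.
have nlt (h k : R -> R) : continuous h -> continuous k ->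
    (forall a b, \int[mu]_x (h x * cutoff a b 0 x) = \int[mu]_x (k x * cutoff a b 0 x)) ->
    forall x, ~ (k x < h x).
  move=> ch ck E x kh.
  have cr : continuous (fun x => h x - k x) by apply: continuous_add => //; exact: continuous_opp.
  have rx : 0 < h x - k x by rewrite subr_gt0.
  have /nbhs_ballP[e /= e0 He] : \forall y \near x, 0 < h y - k y.
    exact: (cvgr_gt _ (cr x)).
  have I := Ib _ (x - e) (x + e) cr.
  suff : (h x - k x) * cutoff (x - e) (x + e) 0 x = 0.
    by apply/eqP; rewrite mulf_neq0// gt_eqF// cutoff_gt0//; apply/andP; split; lra.
  apply: (int_eq0 (f := fun y => (h y - k y) * cutoff (x - e) (x + e) 0 y)) => //.
    move=> y; have [ye|ye] := ltP `|x - y| e.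
      by rewrite mulr_ge0 ?cutoff_ge0// ltW// He.
    rewrite cutoff_out ?mulr0//.
    by move: ye; rewrite ler_normr => /orP[] ?; apply/orP; [left|right]; lra.
  transitivity (\int[mu]_y (h y * cutoff (x - e) (x + e) 0 y - k y * cutoff (x - e) (x + e) 0 y)).
    by apply: eq_Rintegral => y _; rewrite mulrBl.
  rewrite (intB (Ib _ _ _ ch) (Ib _ _ _ ck)) E; exact: subrr.
apply/funext => x; apply/eqP; rewrite eq_le !leNgt; apply/andP; split; apply/negP.
  exact: (nlt f g).
by apply: (nlt g f) => // a b; rewrite H.
Qed.
End Bump.

(** * From complex envelopes to their real and imaginary parts *)

Local Notation Re := complex.Re.
Local Notation Im := complex.Im.

(* Locked, as unification would otherwise compare iterated derivatives by
   unfolding the limits that define them. *)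
HB.lock Definition rpart {R : realType} (v : R -> R[i]) (n : nat) (x : R) : R :=
  Re (cderiven n v x).
HB.lock Definition ipart {R : realType} (v : R -> R[i]) (n : nat) (x : R) : R :=
  Im (cderiven n v x).

Section Bridge.
Context {R : realType}.
Notation mu := (@lebesgue_measure R).
Implicit Types f g : R -> R.
Implicit Types u v h : R -> R[i].
Implicit Types x s : R.

Lemma complex_eq (z w : R[i]) : Re z = Re w -> Im z = Im w -> z = w.
Proof. by case: z w => ? ? [? ?] /= -> ->. Qed.

Lemma has_derivE f f' x : has_deriv f f' -> f^`() x = f' x.
Proof. by move=> df; rewrite derive1E; case: (df x). Qed.

Lemma derivable_has_deriv f : (forall x, derivable f x 1) -> has_deriv f f^`().
Proof. by move=> df x; rewrite derive1E; exact: derivableP. Qed.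

Lemma rpartE v n : (fun x => Re (cderiven n v x)) = rpart v n.
Proof. by rewrite rpart.unlock. Qed.

Lemma ipartE v n : (fun x => Im (cderiven n v x)) = ipart v n.
Proof. by rewrite ipart.unlock. Qed.

Lemma cderivenE v n x : cderiven n v x = rpart v n x +i* ipart v n x.
Proof. by rewrite rpart.unlock ipart.unlock; case: (cderiven n v x). Qed.

Lemma parts0E v x : v x = rpart v 0 x +i* ipart v 0 x.
Proof. exact: (cderivenE v 0 x). Qed.

Lemma rpartS v n : rpart v n.+1 = (rpart v n)^`().
Proof. by rewrite rpart.unlock. Qed.

Lemma ipartS v n : ipart v n.+1 = (ipart v n)^`().
Proof. by rewrite ipart.unlock. Qed.

(** Uniqueness of derivatives: a chain starting at Re v consists of the iterated
    derivatives of Re v. *)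
Lemma H3_rpart v (a : nat -> R -> R) : H3 a -> rpart v 0 = a 0%N ->
  forall n, (n <= 3)%N -> rpart v n = a n.
Proof.
move=> [da _] v0; elim=> // n IH n3.
rewrite rpartS.
rewrite (IH (ltnW n3)).
apply/funext => x.
exact: has_derivE (da n n3).
Qed.

Lemma H3_ipart v (a : nat -> R -> R) : H3 a -> ipart v 0 = a 0%N ->
  forall n, (n <= 3)%N -> ipart v n = a n.
Proof.
move=> [da _] v0; elim=> // n IH n3.
rewrite ipartS.
rewrite (IH (ltnW n3)).
apply/funext => x.
exact: has_derivE (da n n3).
Qed.

Lemma L2_sumsq f g : continuous f ->
  mu.-integrable setT (fun x => (f x ^+ 2 + g x ^+ 2)%:E) ->
  L2 f.
Proof.
move=> cf I; split => //; apply: (L1_le _ _ I); first exact: continuous_mul.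
by move=> x; rewrite ger0_norm -expr2 ?sqr_ge0// lerDl sqr_ge0.
Qed.

Lemma envelope_H3 v : envelope v -> H3 (rpart v) /\ H3 (ipart v).
Proof.
move=> [dv [[cr ci] sv]].
rewrite rpartE in cr; rewrite ipartE in ci.
have dr n : (n < 3)%N -> has_deriv (rpart v n) (rpart v n.+1).
  move=> n3; rewrite rpartS; apply: derivable_has_deriv => x.
  by have [+ _] := dv n x n3; rewrite rpartE.
have di n : (n < 3)%N -> has_deriv (ipart v n) (ipart v n.+1).
  move=> n3; rewrite ipartS; apply: derivable_has_deriv => x.
  by have [_] := dv n x n3; rewrite ipartE.
have I n : (n <= 3)%N ->
    mu.-integrable setT (fun x => (rpart v n x ^+ 2 + ipart v n x ^+ 2)%:E).
  by move=> n3; have [_ [_]] := sv n n3; rewrite rpart.unlock ipart.unlock.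
split; split=> n n3; try exact: dr; try exact: di.
- apply: (L2_sumsq _ (I n n3)).
  move: n3; rewrite leq_eqVlt => /orP[/eqP ->|n3]; first exact: cr.
  exact: has_deriv_continuous (dr n n3).
- apply: (@L2_sumsq _ (rpart v n)); last first.
    by under eq_fun do rewrite addrC; exact: I.
  move: n3; rewrite leq_eqVlt => /orP[/eqP ->|n3]; first exact: ci.
  exact: has_deriv_continuous (di n n3).
Qed.

Lemma H3_envelope (a b : nat -> R -> R) : H3 a -> H3 b ->
  envelope (fun x => a 0%N x +i* b 0%N x).
Proof.
move=> Ha Hb; set v := fun x => _.
have Er : forall n, (n <= 3)%N -> rpart v n = a n.
  by apply: H3_rpart => //; rewrite -rpartE.
have Ei : forall n, (n <= 3)%N -> ipart v n = b n.
  by apply: H3_ipart => //; rewrite -ipartE.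
have [da La] := Ha; have [db Lb] := Hb.
split; [|split].
- move=> n x n3; split.
    by rewrite rpartE (Er _ (ltnW n3)); case: (da n n3 x).
  by rewrite ipartE (Ei _ (ltnW n3)); case: (db n n3 x).
- split; first by rewrite rpartE (Er 3%N isT); case: (La 3%N isT).
  by rewrite ipartE (Ei 3%N isT); case: (Lb 3%N isT).
- move=> n n3; have {}Er := Er n n3; have {}Ei := Ei n n3.
  have [Ia ca] := La n n3; have [Ib cb] := Lb n n3.
  split; first by rewrite rpartE Er; exact: continuous_measurable_fun.
  split; first by rewrite ipartE Ei; exact: continuous_measurable_fun.
  have [_ I] := L1D Ia Ib.
  rewrite (_ : (fun x => _) = EFin \o (fun x => a n x * a n x + b n x * b n x))//.
  by apply/funext => x; rewrite cderivenE /= Er Ei !expr2.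
Qed.

Lemma sqr_norm_sqmod v x : `|v x| ^+ 2 = (sqmod (rpart v) (ipart v) x)%:C.
Proof. by rewrite -add_Re2_Im2 !expr2 [v x]parts0E. Qed.

(** The integrand defining |D|f is F + i G, with G odd in the frequency because FC is
    even and FS odd. *)
Lemma absD_real f x : W31 f -> absD (fun y => (f y)%:C) x = (absDr f x)%:C.
Proof.
move=> Wf; have If := W31_L1 Wf; have [IC IS] := W31_decay Wf.
have cc := @continuous_cos R; have cs := @continuous_sin R.
have Ef l : fourier (fun y => (f y)%:C) l = osc (@cos R) f l +i* (- osc (@sin R) f l).
  apply: complex_eq => /=.
    apply: eq_Rintegral => y _ /=; rewrite mul0r subr0 cosN mulrC; ring.
  rewrite -[RHS]mulN1r /osc -(intZ (-1) (osc_L1 cs (@normr_sin_le1 R) l If)).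
  apply: eq_Rintegral => y _ /=; rewrite mul0r addr0 sinN; ring.
pose F l := `|l| * osc (@cos R) f l * cos (x * l) + `|l| * osc (@sin R) f l * sin (x * l).
pose G l := `|l| * osc (@cos R) f l * sin (x * l) - `|l| * osc (@sin R) f l * cos (x * l).
have EI : (fun l => `|l|%:C * fourier (fun y => (f y)%:C) l * expi (l * x)) =
    (fun l => F l +i* G l).
  apply/funext => l; rewrite Ef /expi /F /G [l * x]mulrC.
  apply: complex_eq => /=; ring.
have J1 := osc_L1 cc (@normr_cos_le1 R) x IC.
have J2 := osc_L1 cs (@normr_sin_le1 R) x IS.
have IF : \int[mu]_l F l = osc (@cos R) (fun l => `|l| * osc (@cos R) f l) x +
    osc (@sin R) (fun l => `|l| * osc (@sin R) f l) x by exact: intD J1 J2.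
have IG : \int[mu]_l G l = 0.
  apply: int_odd.
    apply: L1B; first exact: (osc_L1 cs (@normr_sin_le1 R) x IC).
    exact: (osc_L1 cc (@normr_cos_le1 R) x IS).
  have oC l : osc (@cos R) f (- l) = osc (@cos R) f l.
    by apply: eq_Rintegral => y _; rewrite mulNr cosN.
  have oS l : osc (@sin R) f (- l) = - osc (@sin R) f l.
    rewrite -[RHS]mulN1r /osc -(intZ (-1) (osc_L1 cs (@normr_sin_le1 R) l If)).
    by apply: eq_Rintegral => y _; rewrite mulNr sinN mulrN mulN1r.
  by move=> l; rewrite /G oC oS mulrN cosN sinN normrN; ring.
rewrite /absD EI /cintegral /= IF IG -[_ +i* 0]/(_%:C) -rmorphM.
by [].
Qed.

Lemma Im_conjM v n x : Im ((v x)^* * cderiven n v x) =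
  rpart v 0 x * ipart v n x - ipart v 0 x * rpart v n x.
Proof.
rewrite (cderivenE v n) (parts0E v x) /=; ring.
Qed.

Lemma H3_ext (a b : nat -> R -> R) : (forall n, (n <= 3)%N -> a n = b n) ->
  H3 b -> H3 a.
Proof.
move=> E [db Lb]; split=> n n3; last by rewrite (E n n3); exact: Lb.
by rewrite (E n (ltnW n3)) (E n.+1 n3); exact: db.
Qed.

Lemma density_ext (c0 c1 c2 c3 c4 c5 c6 : R) (a b a' b' : nat -> R -> R) :
  (forall n, (n <= 3)%N -> a n = a' n) -> (forall n, (n <= 3)%N -> b n = b' n) ->
  density c0 c1 c2 c3 c4 c5 c6 a b = density c0 c1 c2 c3 c4 c5 c6 a' b'.
Proof.
move=> Ea Eb; have Erho : sqmod a b = sqmod a' b'.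
  by apply/funext => y; rewrite /sqmod (Ea 0%N isT) (Eb 0%N isT).
apply/funext => x; rewrite /density /current Erho.
by rewrite !(Ea 0%N isT, Ea 1%N isT, Ea 3%N isT, Eb 0%N isT, Eb 1%N isT, Eb 3%N isT).
Qed.

(** The integrand of the Hamiltonian, with arbitrary coefficients, takes real values. *)
Lemma cintegral_density (c0 c1 c2 c3 c4 c5 c6 : R) v : H3 (rpart v) -> H3 (ipart v) ->
  cintegral (fun X =>
    c0%:C * `|v X| ^+ 2
    + c1%:C * (Im ((v X)^* * cderiven 1 v X))%:C
    + c2%:C * `|cderiven 1 v X| ^+ 2
    + c3%:C * `|v X| ^+ 4
    - c4%:C * (Im ((v X)^* * cderiven 3 v X))%:C
    + c5%:C * `|v X| ^+ 2 * (Im ((v X)^* * cderiven 1 v X))%:C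
    - c6%:C * `|v X| ^+ 2 * absD (fun Y => `|v Y| ^+ 2) X) =
  (\int[mu]_x density c0 c1 c2 c3 c4 c5 c6 (rpart v) (ipart v) x)%:C.
Proof.
move=> Hr Hi.
have -> : (fun Y => `|v Y| ^+ 2) = (fun Y => (sqmod (rpart v) (ipart v) Y)%:C).
  by apply/funext => Y; exact: sqr_norm_sqmod.
have W := sqmod_W31 Hr Hi.
have E X : `|v X| ^+ 4 = (sqmod (rpart v) (ipart v) X * sqmod (rpart v) (ipart v) X)%:C.
  by rewrite (exprM _ 2 2) sqr_norm_sqmod rmorphM expr2.
have E1 X : `|cderiven 1 v X| ^+ 2 =
    (rpart v 1 X * rpart v 1 X + ipart v 1 X * ipart v 1 X)%:C.
  by rewrite -add_Re2_Im2 !expr2 cderivenE.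
rewrite (_ : (fun X => _) =
    fun X => (density c0 c1 c2 c3 c4 c5 c6 (rpart v) (ipart v) X)%:C); last first.
  apply/funext => X; rewrite E E1 !Im_conjM sqr_norm_sqmod (absD_real X W) /density /current.
  move: (sqmod _ _ X) (absDr _ X) => r A; move: (rpart v) (ipart v) => a b.
  apply: complex_eq => /=; ring.
apply: complex_eq => //=.
by rewrite /Rintegral integral0.
Qed.

Section Hamiltonian.
Variables (g D P k0 eps gamma : R).

Local Notation dw n := (derive1n n (omega g D P) k0).
(* The coefficients of the seven terms of the Hamiltonian. *)
Let e0 := eps * omega g D P k0.
Let e1 := eps ^+ 2 * dw 1.
Let e2 := eps ^+ 3 * dw 2 / 2.
Let e3 := eps ^+ 3 * alpha g D P k0 / 2.
Let e4 := eps ^+ 4 * dw 3 / 6.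
Let e5 := eps ^+ 4 * beta g D P k0 / 2.
Let e6 := eps ^+ 4 * gamma * k0 ^+ 2 / 4.
Local Notation H := (hamiltonian g D P k0 eps gamma).
Local Notation dens := (density e0 e1 e2 e3 e4 e5 e6).
Local Notation Q1 v := (grad_re e0 e1 e2 e3 e4 e5 e6 (rpart v) (ipart v)).
Local Notation Q2 v := (grad_im e0 e1 e2 e3 e4 e5 e6 (rpart v) (ipart v)).

Lemma hamiltonianE v : H3 (rpart v) -> H3 (ipart v) ->
  H v = (\int[mu]_x dens (rpart v) (ipart v) x)%:C.
Proof. exact: cintegral_density. Qed.

(** The Hamiltonian is real, so its first variation is real linear in h = phi + i psi:
    2 (q1 phi + q2 psi) = p h + q conj h, with q = q1 + i q2 and p = conj q. *)
Lemma hamiltonian_variational_derivatives v : envelope v ->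
  is_variational_derivatives H v (fun x => Q1 v x -i* Q2 v x) (fun x => Q1 v x +i* Q2 v x).
Proof.
move=> Ev; have [Hr Hi] := envelope_H3 Ev.
have L1q := grad_re_L2 e0 e1 e2 e3 e4 e5 e6 Hr Hi.
have L2q := grad_im_L2 e0 e1 e2 e3 e4 e5 e6 Hr Hi.
have c1 : continuous (Q1 v) by case: L1q.
have c2 : continuous (Q2 v) by case: L2q.
split.
- by split => //=; exact: continuous_opp.
- by split.
move=> h Eh _; have [Hhr Hhi] := envelope_H3 Eh.
have HE s : H (fun x => v x + s%:C * h x) =
    (\int[mu]_x dens (fun n x => rpart v n x + s * rpart h n x)
                     (fun n x => ipart v n x + s * ipart h n x) x)%:C.
  have Hrs := H3D s Hr Hhr; have His := H3D s Hi Hhi.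
  set vs := fun x => v x + s%:C * h x.
  have r0 : rpart vs 0 = fun x => rpart v 0 x + s * rpart h 0 x.
    apply/funext => x; rewrite -rpartE /vs /= {1}(parts0E v) {1}(parts0E h) /=; ring.
  have i0 : ipart vs 0 = fun x => ipart v 0 x + s * ipart h 0 x.
    apply/funext => x; rewrite -ipartE /vs /= {1}(parts0E v) {1}(parts0E h) /=; ring.
  have Er := H3_rpart Hrs r0; have Ei := H3_ipart His i0.
  rewrite (hamiltonianE (H3_ext Er Hrs) (H3_ext Ei His)).
  by rewrite (density_ext e0 e1 e2 e3 e4 e5 e6 Er Ei).
have F := first_variation e0 e1 e2 e3 e4 e5 e6 Hr Hi Hhr Hhi.
set Fh := fun s : R => H (fun x => v x + s%:C * h x).
have Fr : (fun s => Re (Fh s)) =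
    (fun s => \int[mu]_x dens (fun n x => rpart v n x + s * rpart h n x)
                     (fun n x => ipart v n x + s * ipart h n x) x).
  by apply/funext => s; rewrite /Fh HE.
have Fi : (fun s => Im (Fh s)) = (fun=> 0).
  by apply/funext => s; rewrite /Fh HE.
split.
  split; first by rewrite Fr; case: F.
  by rewrite Fi; exact: derivable_cst.
apply: complex_eq; rewrite /cderive /=.
  rewrite Fr derive1E; case: F => _ ->; apply: eq_Rintegral => x _.
  rewrite (parts0E h x) /=; ring.
rewrite Fi derive1_cst; symmetry.
transitivity (\int[mu]_(x in [set: R]) (0 : R)); last by rewrite /Rintegral integral0.
by apply: eq_Rintegral => x _; case: (h x) => ? ? /=; ring.
Qed.

End Hamiltonian.

Lemma cutoff_envelope (c : R[i]) (a b : R) :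
  envelope (fun x : R => c * (cutoff a b 0 x)%:C) /\
  compactly_supported (fun x : R => c * (cutoff a b 0 x)%:C).
Proof.
split.
  have HZ r : H3 (fun n x => 0 + r * cutoff a b n x).
    apply: H3D; last exact: cutoff_H3.
    by split => n _; [exact: has_deriv_cst|exact: L2_0].
  have -> : (fun x : R => c * (cutoff a b 0 x)%:C) =
      fun x => (0 + Re c * cutoff a b 0 x) +i* (0 + Im c * cutoff a b 0 x).
    by apply/funext => x; apply: complex_eq; case: c => ? ? /=; ring.
  exact: H3_envelope (HZ _) (HZ _).
exists (`|a| + `|b|) => x xM; rewrite cutoff_out ?mulr0//.
have := ler_norm a; have := ler_norm (- a); have := ler_norm b; have := ler_norm (- b).
rewrite !normrN; move: xM; rewrite real_ltr_normr ?num_real// => /orP[] h ? ? ? ?.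
  by apply/orP; right; have := normr_ge0 a; lra.
by apply/orP; left; have := normr_ge0 b; lra.
Qed.

(** Testing against c times a real cutoff isolates the combination
    p c + q (conjugate of c); the values 1 and i of c separate p from q. *)
Lemma variational_derivatives_unique (F : (R -> R[i]) -> R[i]) v p q p' q' :
  is_variational_derivatives F v p q -> is_variational_derivatives F v p' q' ->
  p = p' /\ q = q'.
Proof.
move=> [cp cq E] [cp' cq' E'].
pose m (P Q : R -> R[i]) (c : R[i]) x := P x * c + Q x * c^*.
have cm P Q c : ccontinuous P -> ccontinuous Q -> ccontinuous (m P Q c).
  move=> [Pr Pi] [Qr Qi]; split.
    rewrite (_ : (fun x => _) = fun x =>
      Re c * (Re (P x) + Re (Q x)) + Im c * (Im (Q x) + - Im (P x))).
      by do !(first [exact: continuous_cst|apply: continuous_add|apply: continuous_mul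
        |apply: continuous_opp|assumption]).
    apply/funext => x; rewrite /m; case: c (P x) (Q x) => ? ? [? ?] [? ?] /=; ring.
  rewrite (_ : (fun x => _) = fun x =>
    Re c * (Im (P x) + Im (Q x)) + Im c * (Re (P x) + - Re (Q x))).
    by do !(first [exact: continuous_cst|apply: continuous_add|apply: continuous_mul
      |apply: continuous_opp|assumption]).
  apply/funext => x; rewrite /m; case: c (P x) (Q x) => ? ? [? ?] [? ?] /=; ring.
have pull (z w c : R[i]) (r : R) :
    (z * c + w * c^*) * r%:C = z * (c * r%:C) + w * (c * r%:C)^*.
  by case: z w c => ? ? [? ?] [? ?]; apply: complex_eq => /=; ring.
have I c a b : cintegral (fun x => m p q c x * (cutoff a b 0 x)%:C) =
    cintegral (fun x => m p' q' c x * (cutoff a b 0 x)%:C).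
  have [eh sh] := cutoff_envelope c a b.
  have [_ EI] := E _ eh sh; have [_ EI'] := E' _ eh sh.
  have mE P Q : (fun x => m P Q c x * (cutoff a b 0 x)%:C) = (fun x =>
      P x * (c * (cutoff a b 0 x)%:C) + Q x * (c * (cutoff a b 0 x)%:C)^*).
    by apply/funext => x; exact: pull.
  by rewrite !mE; exact: etrans (esym EI) EI'.
have ReM (z : R[i]) (r : R) : Re (z * r%:C) = Re z * r by case: z => ? ? /=; ring.
have ImM (z : R[i]) (r : R) : Im (z * r%:C) = Im z * r by case: z => ? ? /=; ring.
have M c x : m p q c x = m p' q' c x.
  have [mr mi] := cm p q c cp cq; have [mr' mi'] := cm p' q' c cp' cq'.
  apply: complex_eq.
    apply: (congr1 (@^~ x) (fundamental_lemma mr mr' _)) => a b.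
    have /(congr1 (@Re R)) /= := I c a b.
    by under eq_Rintegral do rewrite ReM; under [RHS]eq_Rintegral do rewrite ReM.
  apply: (congr1 (@^~ x) (fundamental_lemma mi mi' _)) => a b.
  have /(congr1 (@Im R)) /= := I c a b.
  by under eq_Rintegral do rewrite ImM; under [RHS]eq_Rintegral do rewrite ImM.
split; apply/funext => x; have := M 1 x; have := M 'i x; rewrite /m;
  case: (p x) (q x) (p' x) (q' x) => ? ? [? ?] [? ?] [? ?] /= [] A B [] C D;
  apply: complex_eq => /=; lra.
Qed.

Lemma variational_derivativesE (F : (R -> R[i]) -> R[i]) v p q :
  is_variational_derivatives F v p q -> d_u F v = p /\ d_ubar F v = q.
Proof.
move=> Epq; rewrite /d_u /d_ubar /variational_derivatives.
case: xgetP => [pq _ /= Hpq|/(_ (p, q)) /=]; last by move=> /(_ Epq).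
exact: variational_derivatives_unique Hpq Epq.
Qed.

End Bridge.

(** For v = u(., t), eps^-1 times the derivative with respect to the conjugate is the
    right-hand side of the Dysthe equation, coefficient by coefficient. *)
Lemma scaled_gradient_dysthe (R : realType) (w w1 w2 w3 al be gamma k0 eps : R)
    (v : R -> R[i]) (x : R) :
  eps != 0 -> H3 (rpart v) -> H3 (ipart v) ->
  let grad (F : R -> R -> R -> R -> R -> R -> R -> (nat -> R -> R) -> (nat -> R -> R) ->
      R -> R) := F (eps * w) (eps ^+ 2 * w1) (eps ^+ 3 * w2 / 2) (eps ^+ 3 * al / 2)
      (eps ^+ 4 * w3 / 6) (eps ^+ 4 * be / 2) (eps ^+ 4 * gamma * k0 ^+ 2 / 4)
      (rpart v) (ipart v) x in
  (eps^-1)%:C * (grad grad_re +i* grad grad_im) =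
    w%:C * v x
    - 'i * (eps * w1)%:C * cderiven 1 v x
    - (eps ^+ 2 * w2 / 2)%:C * cderiven 2 v x
    + (eps ^+ 2 * al)%:C * `|v x| ^+ 2 * v x
    + 'i / 6 * (eps ^+ 3 * w3)%:C * cderiven 3 v x
    - 'i * (eps ^+ 3 * be)%:C * `|v x| ^+ 2 * cderiven 1 v x
    - (eps ^+ 3 * (gamma * k0 ^+ 2 / 2))%:C * v x * absD (fun y => `|v y| ^+ 2) x.
Proof.
move=> e0 Hr Hi grad; rewrite {}/grad.
have -> : (fun y => `|v y| ^+ 2) = (fun y => (sqmod (rpart v) (ipart v) y)%:C).
  by apply/funext => y; exact: sqr_norm_sqmod.
rewrite (absD_real x (sqmod_W31 Hr Hi)) sqr_norm_sqmod.
have -> : 'i / 6 = 0 +i* 6^-1 :> R[i].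
  have -> : (6 : R[i]) = (6 : R)%:C by rewrite rmorph_nat.
  by rewrite -fmorphV; apply: complex_eq => /=; ring.
rewrite (parts0E v x) (cderivenE v 1 x) (cderivenE v 2 x) (cderivenE v 3 x).
rewrite /grad_re /grad_im; move: (sqmod _ _ x) (absDr _ x) => r A.
move: (rpart v) (ipart v) => a b.
by apply: complex_eq => /=; field.
Qed.

Theorem mainTheorem2 (R : realType) (g D P k0 eps gamma : R)
    (hg : g = 1) (hD : D = 1) (hP : 0 <= P < 2)
    (hk0 : 0 < k0) (heps : 0 < eps)
    (hgamma1 : k0 = 9 / 10 -> gamma = 2) (hgamma2 : k0 = 2 -> gamma = 1) :
  (forall v : R -> R[i], envelope v ->
     exists! pq : (R -> R[i]) * (R -> R[i]),
       is_variational_derivatives (hamiltonian g D P k0 eps gamma) v pq.1 pq.2)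
  /\
  (forall (u : R -> R -> R[i]) (t : R),
     envelope (u^~ t) -> (forall X, cderivable (u X) t) ->
     (hamiltonian_system g D P k0 eps gamma u t <->
        hamiltonian_equation g D P k0 eps gamma u t) /\
     (hamiltonian_system g D P k0 eps gamma u t <->
        dysthe_equation g D P k0 eps gamma u t)).
Proof.
have e0 : eps != 0 by rewrite gt_eqF.
split.
  move=> v Ev; have V := hamiltonian_variational_derivatives g D P k0 eps gamma Ev.
  eexists (_, _); split; first exact: V.
  by move=> [p q] /= /(variational_derivatives_unique V)[-> ->].
move=> u t Eu du.
have [dU dUb] := variational_derivativesE
  (hamiltonian_variational_derivatives g D P k0 eps gamma Eu).
have [Hr Hi] := envelope_H3 Eu.
(* The second equation of the system is the conjugate of the first. *)
have conj_deriv X : cderive (fun s => (u X s)^*) t = (cderive (u X) t)^*.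
  apply: complex_eq; rewrite /cderive /=.
    by congr (derive1 _ t); apply/funext => s; case: (u X s).
  have [_ di] := du X.
  rewrite (_ : (fun y => Im (u X y)^*) = - (fun y => Im (u X y))); last first.
    by apply/funext => s; rewrite fctE; case: (u X s).
  by rewrite !derive1E deriveN.
have E1 : hamiltonian_system g D P k0 eps gamma u t <->
    hamiltonian_equation g D P k0 eps gamma u t.
  rewrite /hamiltonian_system /hamiltonian_equation dU dUb; split => h X.
    have [-> _] := h X.
    by apply: complex_eq => /=; ring.
  have hX := h X.
  have hX' : cderive (u X) t = - 'i * ('i * cderive (u X) t).
    by case: (cderive _ _) => ? ? ; apply: complex_eq => /=; ring.
  rewrite conj_deriv hX' hX.
  by split; apply: complex_eq => /=; ring.
split => //.
apply: (iff_trans E1).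
rewrite /hamiltonian_equation /dysthe_equation dUb.
have G := scaled_gradient_dysthe _ _ _ _ _ _ gamma k0 _ e0 Hr Hi.
by split => h X; rewrite h G.
Qed.
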